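(* Let $m\geq 4$ and $g_0\in L^\infty_m(\mathbb{S}^1)$, and let $g,G$ be the solution of \[ \partial_t g+2G\,\partial_\theta g=0,\qquad (4+\partial_{\theta\theta})G=g,\qquad g(0,\cdot)=g_0 . \] Denote by $\chi$ the Lagrangian flow map on $\mathbb{S}^1$, i.e. the solution of \[ \frac{d}{dt}\chi(t,\theta)=2G(t,\chi(t,\theta)),\qquad \chi(0,\theta)=\theta . \] Then for every $\theta\in\mathbb{S}^1$ there exists $T(\theta)\in[0,\infty]$ such that $t\mapsto\partial_\theta\chi(t,\theta)$ is increasing on $[0,T(\theta))$ and decreasing on $[T(\theta),\infty)$. In other words, the set \[ C(t):=\{\theta:\ \partial_t\partial_\theta\chi(t,\theta)<0\} \] is non-decreasing in $t$ with respect to set inclusion. Moreover, the set $E:=\{\theta:\ T(\theta)=+\infty\}$ (the expanding set) is closed, and the set $C:=\{\theta:\ T(\theta)<\infty\}$ (the eventually contracting set) is open, with $\partial_\theta\chi(t,\theta)$ decreasing to $0$ for $t\in[T(\theta),\infty)$ for every $\theta\in C$. Furthermore, either $g(t,\cdot)$ converges weakly to the constant $\frac{1}{2\pi}\int_{\mathbb{S}^1}g_0$ as $t\to+\infty$, or $E$ is a finite set.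
   Context: $\mathbb{S}^1=\mathbb{R}/2\pi\mathbb{Z}$ with coordinate $\theta$. For $m\in\mathbb{N}$, $L^\infty_m(\mathbb{S}^1)$ denotes the bounded measurable functions $g$ on $\mathbb{S}^1$ that are $m$-fold symmetric, i.e. $g(\theta+2\pi/m)=g(\theta)$. For $m\geq 3$, the operator $4+\partial_{\theta\theta}$ is invertible on $m$-fold symmetric functions (their Fourier modes are multiples of $m$, so the modes $\pm2$ are absent), so $G=(4+\partial_{\theta\theta})^{-1}g$ is well defined; for $g_0\in L^\infty_m(\mathbb{S}^1)$, $m\ge 3$, the system above has a unique global solution $g\in L^\infty(\mathbb{R},L^\infty_m(\mathbb{S}^1))\cap C^0(\mathbb{R},L^1_m(\mathbb{S}^1))$, with $G(t,\cdot)\in W^{2,\infty}$, so the flow $\chi$ is well defined. This system is the equation satisfied by the angular profile $g(t,\theta)=\omega(t,r,\theta)$ of scale-invariant ($0$-homogeneous) $m$-fold symmetric solutions $\omega$ of the 2d Euler equation. *)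

(* Defs.v *)
From mathcomp Require Import all_boot all_order all_algebra.
From mathcomp Require Import all_classical all_reals all_analysis.
Set Implicit Arguments. Unset Strict Implicit. Unset Printing Implicit Defensive.
Import Order.TTheory GRing.Theory Num.Theory.
Import numFieldNormedType.Exports.
Local Open Scope classical_set_scope.
Local Open Scope ring_scope.

(* Functions on S^1 = R/2piZ are represented as functions on R (lifts).
   m-fold symmetry: f (x + 2 pi / m) = f x (this implies 2 pi-periodicity). *)
Definition msym (R : realType) (m : nat) (f : R -> R) : Prop :=
  forall x, f (x + 2 * pi / m%:R) = f x.

Definition dth (R : realType) (f : R -> R -> R) (t x : R) : R := derive1 (f t) x.
Definition dt (R : realType) (f : R -> R -> R) (t x : R) : R :=
  derive1 (fun s => f s x) t.

(* Gt = (4 + d_theta theta)^{-1} gt on m-fold symmetric functions: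
   Gt is m-fold symmetric, C^1, and Gt' is absolutely continuous with
   Gt'' = gt - 4 Gt a.e. (i.e. Gt in W^{2,oo} solves (4 + d_thth) Gt = gt). *)
Definition solves_elliptic (R : realType) (m : nat) (gt Gt : R -> R) : Prop :=
  msym m Gt /\ (forall x, derivable Gt x 1) /\
  forall a b, a <= b ->
    derive1 Gt b - derive1 Gt a =
    Rintegral lebesgue_measure `[a, b] (fun x => gt x - 4 * Gt x).

Definition test_function (R : realType) (phi : R -> R -> R) : Prop :=
  (forall t x, phi t (x + 2 * pi) = phi t x) /\
  (exists K : R, forall t x, K < `|t| -> phi t x = 0) /\
  (forall t x, derivable (fun s => phi s x) t 1 /\ derivable (phi t) x 1) /\
  continuous (fun p : R * R => phi p.1 p.2) /\
  continuous (fun p : R * R => dt phi p.1 p.2) /\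
  continuous (fun p : R * R => dth phi p.1 p.2).

(* distributional form of  d_t g + 2 G d_theta g = 0  on R x S^1
   (2 G d_th g is understood as d_th(2 G g) - 2 (d_th G) g, G Lipschitz) *)
Definition weak_transport (R : realType) (g G : R -> R -> R) : Prop :=
  forall phi, test_function phi ->
    Rintegral lebesgue_measure setT (fun t =>
      Rintegral lebesgue_measure `[0, 2 * pi] (fun x =>
        g t x * (dt phi t x + 2 * (G t x * dth phi t x + dth G t x * phi t x))))
    = 0.

(* (g, G) is the global solution with initial datum g0, in the class
   g in L^oo(R, L^oo_m(S^1)) cap C^0(R, L^1_m(S^1)). *)
Definition is_solution (R : realType) (m : nat) (g0 : R -> R) (g G : R -> R -> R)
  : Prop :=
  measurable_fun setT (fun p : R * R => g p.1 p.2) /\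
  (exists M : R, forall t x, `|g t x| <= M) /\
  (forall t, msym m (g t)) /\
  (forall s, Rintegral lebesgue_measure `[0, 2 * pi] (fun x => `|g t x - g s x|)
               @[t --> s] --> (0 : R)) /\
  {ae lebesgue_measure, forall x, g 0 x = g0 x} /\
  (forall t, solves_elliptic m (g t) (G t)) /\
  weak_transport g G.

Definition is_flow (R : realType) (G chi : R -> R -> R) : Prop :=
  (forall th, chi 0 th = th) /\
  forall t th, derivable (fun s => chi s th) t 1 /\
               derive1 (fun s => chi s th) t = 2 * G t (chi t th).

Definition Cset (R : realType) (chi : R -> R -> R) (t : R) : set R :=
  [set th | dt (dth chi) t th < 0].

Definition Eset (R : realType) (T : R -> \bar R) : set R :=
  [set th | T th = +oo%E].
Definition Cinf (R : realType) (T : R -> \bar R) : set R :=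
  [set th | (T th < +oo)%E].

Definition mean (R : realType) (f : R -> R) : R :=
  (2 * pi)^-1 * Rintegral lebesgue_measure `[0, 2 * pi] f.

(* Main.v *)
Require Import Defs.
From mathcomp Require Import all_boot all_order all_algebra.
From mathcomp Require Import all_classical all_reals all_analysis.
From mathcomp Require Import measurable_realfun ring lra.
Import Order.TTheory GRing.Theory Num.Theory.
Import numFieldNormedType.Exports.
Set Implicit Arguments. Unset Strict Implicit. Unset Printing Implicit Defensive.
Local Open Scope classical_set_scope.
Local Open Scope ring_scope.

(** With [H = (4 + d_thth)^-1 (G'^2)], the equation for [g] amounts to
    [d_t G + 2 G G' = 3 H'], that is [chi_tt = 6 H'(t, chi)] along the flow.
    Differentiating in [th], the Jacobian [J = d_th chi] satisfies
    [J_tt = 6 (G'^2 - 4 H) J] and [J_t = 2 G' J], so [p = J^(-1/2)] satisfies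
    [p_tt = 12 H p].  For [m >= 4] the Green kernel of [4 + d_thth] on
    [m]-fold symmetric functions is nonnegative, hence [H >= 0] and [p] is
    convex in time: once [p] increases ([J] decreases) it does so forever, at
    least linearly, and [J -> 0].

    If [G'] does not tend to [0] uniformly, there are arbitrarily late time
    windows on which [H] is bounded below; on these [G' >= k > 0] at every
    point coming from [E].  When two points of [E] are close together at
    infinitely many such times, everything in between lies in [E], and the gap
    between them grows without bound, which is absurd on the circle; so at
    late such times any finitely many points of [E] are a fixed distance apart,
    and [E] is finite.
    If [G' -> 0], then [int_a^b g = G'(b) - G'(a) + 4 int_a^b G] gives the
    weak convergence. *)

(** * Primitives of locally bounded measurable functions *)

(** The obstacle is regularity. [g] is only bounded, so [G'] is only Lipschitz in space and the
    equation for [g] holds only against test functions. A rough function therefore enters through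
    its primitive, and no derivative is taken almost everywhere. The law for [d_t G] rests on 2 G g'
    = (4 + d_thth)(2 G G') - 3 (G'^2)', proved in duality: the test function is psi and the
    computation is carried by f = (4 + d_thth) psi, so that [g] disappears and all terms are
    continuous in time. The formula for [J_tt] would formally require d_t G', which contains the
    rough G''. It is obtained instead by comparing two trajectories with nearby labels, integrating
    in time, and identifying the part linear in the difference of labels.

    The exponent in p = J^(-1/2) linearises a Riccati equation: s = G'(t, chi) satisfies s_t = s^2 -
    12 H, and p_t = - s p makes the terms in s^2 cancel in p_tt. *)

Section Calculus.
Context {R : realType}.
Notation mu := (@lebesgue_measure R).
Implicit Types (f g F u v : R -> R) (a b c x y C M : R).

(** Form without quotient, with a non-strict bound and y = x allowed, so that integral estimates can
    be plugged in directly. *)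
Lemma is_derive_epsP f x l :
  (forall e : R, 0 < e -> exists2 d : R, 0 < d & forall y : R, `|y - x| < d ->
     `|f y - f x - l * (y - x)| <= e * `|y - x|) <->
  is_derive x 1 f l.
Proof.
split=> [H|[dfx dfl] e e0].
- have cv : h^-1 *: (f (h *: (1:R) + x) - f x) @[h --> 0^'] --> l.
    apply/cvgrPdist_le => e e0; have [d d0 Hd] := H _ e0.
    exists d => //= h /=; rewrite sub0r normrN => hd h0.
    have := Hd (h *: 1 + x); rewrite addrK /GRing.scale /= mulr1 => /(_ hd).
    move=> K; rewrite -(ler_pM2r (x := `|h|)) ?normr_gt0// -normrM.
    rewrite mulrBl mulrAC mulVf// mul1r distrC; exact: K.
  split; first by apply/cvg_ex; exists l.
  by rewrite /derive; apply: cvg_lim => //.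
- have : h^-1 *: (f (h *: (1:R) + x) - f x) @[h --> 0^'] --> l.
    by rewrite -dfl /derive; apply: dfx.
  move=> /cvgrPdist_le /(_ _ e0)[d /= d0 Hd]; exists d => // y yd.
  have [->|yx] := eqVneq y x; first by rewrite !subrr mulr0 subr0 normr0 mulr0.
  have yx0 : y - x != 0 by rewrite subr_eq0.
  have := Hd (y - x); rewrite /= sub0r normrN => /(_ yd yx0).
  rewrite /GRing.scale /= mulr1 subrK => K.
  rewrite (_ : _ - _ - _ = - ((l - (y - x)^-1 * (f y - f x)) * (y - x))); last by field.
  by rewrite normrN normrM ler_wpM2r.
Qed.

Lemma continuous_at_epsP f x :
  (forall e : R, 0 < e -> exists2 d : R, 0 < d & forall y : R, `|y - x| < d ->
     `|f y - f x| <= e) <-> {for x, continuous f}.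
Proof.
split=> [H|H].
- apply/cvgrPdist_le => e e0; have [d d0 Hd] := H _ e0.
  by exists d => //= y /=; rewrite distrC [in X in _ -> X]distrC => /Hd.
- move=> e e0; move/cvgrPdist_le: H => /(_ _ e0)[d /= d0 Hd]; exists d => // y yd.
  by rewrite distrC; apply: Hd; rewrite /= distrC.
Qed.

Definition locally_bounded f := forall r : R, exists M, forall x, `|x| <= r -> `|f x| <= M.

(** A class that contains the vorticity and all continuous functions, is stable under sums and
    products, and is integrable on every segment: integrability then follows from closure
    properties. *)
Definition lbm f := measurable_fun setT f /\ locally_bounded f.

Lemma continuous_lbm f : continuous f -> lbm f.
Proof.
move=> cf; split; first exact: continuous_measurable_fun.
move=> r; have cpt : compact (f @` `[-r, r]).
  apply: continuous_compact; last exact: segment_compact.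
  exact: continuous_subspaceT.
have /compact_bounded[M [_ HM]] := cpt; exists (`|M| + 1) => x xr.
apply: HM; first by rewrite ltr_pwDr// ler_norm.
by exists x => //=; rewrite in_itv/= -ler_norml.
Qed.

Lemma bounded_lbm f M : measurable_fun setT f -> (forall x, `|f x| <= M) -> lbm f.
Proof. by move=> mf bf; split => // r; exists M. Qed.

Lemma lbmD f g : lbm f -> lbm g -> lbm (f \+ g).
Proof.
move=> [mf bf] [mg bg]; split; first exact: measurable_funD.
move=> r; have [M1 H1] := bf r; have [M2 H2] := bg r; exists (M1 + M2) => x xr.
by rewrite (le_trans (ler_normD _ _))// lerD ?H1 ?H2.
Qed.

Lemma lbmM f g : lbm f -> lbm g -> lbm (f \* g).
Proof.
move=> [mf bf] [mg bg]; split; first exact: measurable_funM.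
move=> r; have [M1 H1] := bf r; have [M2 H2] := bg r; exists (M1 * M2) => x xr.
by rewrite normrM ler_pM ?H1 ?H2.
Qed.

Lemma lbm_cst c : lbm (fun=> c).
Proof. by apply: continuous_lbm => x; exact: cst_continuous. Qed.

Lemma lbmZ c f : lbm f -> lbm (fun x => c * f x).
Proof. by move=> lf; apply: (lbmM (lbm_cst c) lf). Qed.

Lemma lbmB f g : lbm f -> lbm g -> lbm (f \- g).
Proof.
move=> lf lg; rewrite (_ : f \- g = f \+ (fun x => -1 * g x)); last first.
  by apply/funext => x /=; rewrite mulN1r.
exact/lbmD/lbmZ.
Qed.

Lemma lbm_norm f : lbm f -> lbm (fun x => `|f x|).
Proof.
move=> [mf bf]; split; first exact: measurableT_comp.
by move=> r; have [M H] := bf r; exists M => x; rewrite normr_id; exact: H.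
Qed.

Lemma lbm_integrable f a b : lbm f -> mu.-integrable `[a, b] (EFin \o f).
Proof.
move=> [mf bf]; apply: measurable_bounded_integrable => //.
- by rewrite /= lebesgue_measure_itv/=; case: ifP => _; rewrite ?ltry// ltry.
- exact: measurable_funTS.
have [M HM] := bf (`|a| + `|b|); exists M; split; first exact: num_real.
move=> K MK x /=; rewrite in_itv/= => /andP[ax xb].
apply: (le_trans (HM x _)) (ltW MK).
rewrite ler_norml (le_trans _ ax) ?(le_trans xb)//.
- by rewrite (le_trans (ler_norm b))// lerDr.
- by have := ler_norm (- a); rewrite normrN; have := normr_ge0 b; lra.
Qed.

(** The signed integral from 0. Integrals over segments become differences of values, with no
    condition on the order of the endpoints. *)
Definition prim f x := if 0 <= x then \int[mu]_(t in `[0, x]) f t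
                       else - \int[mu]_(t in `[x, 0]) f t.

Lemma Rintegral_chasles f a b c : lbm f -> a <= c -> c <= b ->
  \int[mu]_(t in `[a, b]) f t = \int[mu]_(t in `[a, c]) f t + \int[mu]_(t in `[c, b]) f t.
Proof.
move=> lf ac cb; apply/eqP; rewrite addrC -subr_eq; apply/eqP.
rewrite Rintegral_itvB ?bnd_simp//; last exact: lbm_integrable.
rewrite Rintegral_itv_obnd_cbnd//.
by apply: integrableS (lbm_integrable c b lf) => //; apply: subset_itvr; rewrite bnd_simp.
Qed.

Lemma primB f a b : lbm f -> a <= b -> \int[mu]_(t in `[a, b]) f t = prim f b - prim f a.
Proof.
move=> lf ab; rewrite /prim.
have [a0|a0] := leP 0 a.
  rewrite (le_trans a0 ab) (@Rintegral_chasles f 0 b a)//; lra.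
have [b0|b0] := leP 0 b.
  by rewrite (@Rintegral_chasles f a b 0)// ?ltW//; lra.
by rewrite (@Rintegral_chasles f a 0 b)// ?ltW//; lra.
Qed.

Lemma prim0 f : prim f 0 = 0.
Proof. by rewrite /prim lexx set_itv1 Rintegral_set1. Qed.

Lemma eq_prim f g x : f =1 g -> prim f x = prim g x.
Proof. by move=> /funext ->. Qed.

Lemma primD f g x : lbm f -> lbm g -> prim (f \+ g) x = prim f x + prim g x.
Proof.
move=> lf lg; rewrite /prim; case: ifP => _; rewrite RintegralD//= ?opprD//;
  exact: lbm_integrable.
Qed.

Lemma primZ c f x : lbm f -> prim (fun t => c * f t) x = c * prim f x.
Proof.
move=> lf; rewrite /prim; case: ifP => _; rewrite RintegralZl//= ?mulrN//;
  exact: lbm_integrable.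
Qed.

Lemma primBf f g x : lbm f -> lbm g -> prim (f \- g) x = prim f x - prim g x.
Proof.
move=> lf lg; rewrite -mulN1r -primZ// -primD//; last exact: lbmZ.
by apply: eq_prim => t /=; rewrite mulN1r.
Qed.

Lemma prim_cst c x : prim (fun=> c) x = c * x.
Proof.
rewrite /prim; case: ifP => x0; rewrite Rintegral_cst//= lebesgue_measure_itv/= lte_fin.
- by move: x0; rewrite le_eqVlt => /predU1P[<-|x0]; rewrite ?ltxx ?x0/= ?subr0.
- have {}x0 : x < 0 by rewrite ltNge x0.
  by rewrite x0/=; lra.
Qed.

Lemma le_prim f g a b : lbm f -> lbm g -> a <= b ->
  (forall t, a <= t <= b -> f t <= g t) -> prim f b - prim f a <= prim g b - prim g a.
Proof.
move=> lf lg ab fg; rewrite -!primB//; apply: le_Rintegral => //; try exact: lbm_integrable.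

Qed.

Lemma prim_bound f a b C : lbm f ->
  (forall t, Num.min a b <= t <= Num.max a b -> `|f t| <= C) ->
  `|prim f b - prim f a| <= C * `|b - a|.
Proof.
move=> lf; wlog ab : a b / a <= b => [H fC|].
  have [/H|/ltW ba] := leP a b; first exact.
  by rewrite distrC [X in _ * X]distrC; apply: H => //; rewrite minC maxC.
rewrite (min_idPl ab) (max_idPr ab) => fC.
rewrite ler_norml; rewrite (ger0_norm (_ : 0 <= b - a)) ?subr_ge0//.
have cC c : c * (b - a) = prim (fun=> c) b - prim (fun=> c) a by rewrite !prim_cst mulrBr.
rewrite -mulNr !cC !le_prim//; try exact: lbm_cst.
- by move=> t /fC; rewrite ler_norml => /andP[].
- by move=> t /fC; rewrite ler_norml => /andP[].
Qed.

Lemma prim_boundT f C a b : lbm f -> (forall t, `|f t| <= C) ->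
  `|prim f b - prim f a| <= C * `|b - a|.
Proof. by move=> lf fC; apply: prim_bound. Qed.

Lemma prim_norm_le f a b : lbm f -> a <= b ->
  `|prim f b - prim f a| <= prim (fun t => `|f t|) b - prim (fun t => `|f t|) a.
Proof.
move=> lf ab; rewrite -!primB//; last exact: lbm_norm.
by apply: le_normr_Rintegral => //; exact: lbm_integrable.
Qed.

Lemma prim_ge0 f a b : lbm f -> a <= b -> (forall t, a <= t <= b -> 0 <= f t) ->
  0 <= prim f b - prim f a.
Proof.
move=> lf ab f0; rewrite -primB//; apply: Rintegral_ge0 => x /=; rewrite in_itv/=; exact: f0.
Qed.

Lemma prim_homo f a b : lbm f -> a <= b -> (forall t, 0 <= f t) -> prim f a <= prim f b.
Proof. by move=> lf ab f0; rewrite -subr_ge0 prim_ge0. Qed.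

Lemma between_dist a b t : Num.min a b <= t -> t <= Num.max a b -> `|t - a| <= `|b - a|.
Proof.
rewrite ge_min le_max => /orP[]t1 /orP[]t2; case: (ger0P (t - a)) => ?;
  case: (ger0P (b - a)) => ?; lra.
Qed.

Lemma is_derive_prim f x : lbm f -> {for x, continuous f} ->
  is_derive x 1 (prim f) (f x).
Proof.
move=> lf /continuous_at_epsP cf; apply/is_derive_epsP => e /cf[d d0 Hd].
exists d => // y yd.
have -> : prim f y - prim f x - f x * (y - x) =
    prim (f \- (fun=> f x)) y - prim (f \- (fun=> f x)) x.
  by rewrite !primBf ?prim_cst//; [ring|exact: lbm_cst|exact: lbm_cst].
apply: prim_bound; first by apply: lbmB => //; exact: lbm_cst.
move=> t /andP[t1 t2]; apply: Hd; apply: le_lt_trans yd.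
exact: between_dist.
Qed.

Lemma zero_derive_cst f : (forall x, is_derive x 1 f 0) -> forall x y, f x = f y.
Proof. by move=> df x y; apply: is_derive_0_is_cst. Qed.

(** Increments of second order force a zero derivative at every point. This replaces differentiation
    of products of merely Lipschitz functions. *)
Lemma quadratic_cst f C : (forall x y, `|f y - f x| <= C * (y - x) ^+ 2) ->
  forall x y, f x = f y.
Proof.
move=> fC; apply: zero_derive_cst => x; apply/is_derive_epsP => e e0.
exists (e / (`|C| + 1)); first by rewrite divr_gt0// ltr_pwDr.
move=> y yx; rewrite mul0r subr0 (le_trans (fC _ _))//.
rewrite -normr_id -real_normK ?num_real// expr2 mulrA normr_id ler_wpM2r//.
have C1 : 0 < `|C| + 1 by rewrite ltr_pwDr.
move: yx; rewrite ltr_pdivlMr// => yx.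
apply: le_trans (ltW yx); rewrite mulrC ler_wpM2l//.
by rewrite (le_trans (ler_norm _))// lerDl.
Qed.

(* [u v - int (a0 v + u b0)] has increments of second order, so it is constant;
   [a0] and [b0] need not be continuous. *)
Lemma prim_parts (a0 b0 u v : R -> R) M : lbm a0 -> lbm b0 ->
  (forall x, `|a0 x| <= M) -> (forall x, `|b0 x| <= M) ->
  (forall x y, u y - u x = prim a0 y - prim a0 x) ->
  (forall x y, v y - v x = prim b0 y - prim b0 x) ->
  lbm u -> lbm v ->
  forall x y, u y * v y - u x * v x =
    prim (fun t => a0 t * v t + u t * b0 t) y - prim (fun t => a0 t * v t + u t * b0 t) x.
Proof.
move=> la lb aM bM ua vb lu lv x y.
have M0 : 0 <= M by rewrite (le_trans _ (aM 0)).
have uL s t : `|u t - u s| <= M * `|t - s| by rewrite ua prim_boundT.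
have vL s t : `|v t - v s| <= M * `|t - s| by rewrite vb prim_boundT.
set k := fun t => a0 t * v t + u t * b0 t.
have lk : lbm k by apply: lbmD; exact: lbmM.
suff H : u y * v y - prim k y = u x * v x - prim k x by lra.
(* One M^2 comes from the product of the increments of [u] and [v], two from replacing the integrand
   [k] by [k1], in which [u] and [v] are frozen at [x] and whose primitive is explicit. *)
apply: (@quadratic_cst (fun z => u z * v z - prim k z) (M * M *+ 3)) => {}x {}y.
pose k1 t := a0 t * v x + u x * b0 t.
have lk1 : lbm k1.
  by apply: lbmD; apply: lbmM => //; exact: lbm_cst.
have pk1 z : prim k1 z = v x * prim a0 z + u x * prim b0 z.
  rewrite primD; [|exact: lbmM (lbm_cst _)|exact: lbmZ].
  rewrite primZ//; congr (_ + _); rewrite -primZ//.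
  by apply: eq_prim => t /=; rewrite mulrC.
have e1 : u y * v y - prim k y - (u x * v x - prim k x) =
    (u y - u x) * (v y - v x) - (prim (k \- k1) y - prim (k \- k1) x).
  rewrite !primBf// !pk1.
  have := ua x y; have := vb x y => H1 H2; nra.
rewrite e1 mulrS [leRHS]mulrDl; apply: le_trans (ler_normB _ _) _; apply: lerD.
  rewrite normrM -(real_normK (num_real (y - x))) expr2 mulrACA.
  by rewrite ler_pM ?uL ?vL.
rewrite -(real_normK (num_real (y - x))) expr2 mulrA.
apply: prim_bound; first exact: lbmB.
move=> t /andP[t1 t2].
have tx : `|t - x| <= `|y - x|.
  exact: between_dist.
rewrite /= (_ : _ - _ = a0 t * (v t - v x) + (u t - u x) * b0 t); last by rewrite /k /k1; ring.
rewrite (le_trans (ler_normD _ _))// !normrM mulr2n mulrDl -mulrA lerD//.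
  by rewrite ler_pM// (le_trans (vL _ _))// ler_wpM2l.
by rewrite mulrC ler_pM// (le_trans (uL _ _))// ler_wpM2l.
Qed.

Lemma is_derive_continuous f x l : is_derive x 1 f l -> {for x, continuous f}.
Proof.
by move=> [df _]; apply: differentiable_continuous; apply/derivable1_diffP.
Qed.

Lemma derD f g x a b l : is_derive x 1 f a -> is_derive x 1 g b -> l = a + b ->
  is_derive x 1 (fun y => f y + g y) l.
Proof. by move=> df dg ->; exact: (is_deriveD df dg). Qed.

Lemma derB f g x a b l : is_derive x 1 f a -> is_derive x 1 g b -> l = a - b ->
  is_derive x 1 (fun y => f y - g y) l.
Proof. by move=> df dg ->; exact: (is_deriveB df dg). Qed.

Lemma derM f g x a b l : is_derive x 1 f a -> is_derive x 1 g b ->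
  l = a * g x + f x * b -> is_derive x 1 (fun y => f y * g y) l.
Proof.
by move=> df dg ->; apply: is_derive_eq (is_deriveM df dg) _; rewrite /GRing.scale/=; ring.
Qed.

Lemma derZ c f x a l : is_derive x 1 f a -> l = c * a ->
  is_derive x 1 (fun y => c * f y) l.
Proof. by move=> df ->; exact: (is_deriveZ c df). Qed.

Lemma der_comp f g x a b l : is_derive (g x) 1 f a -> is_derive x 1 g b -> l = a * b ->
  is_derive x 1 (fun y => f (g y)) l.
Proof. by move=> df dg ->; exact: (is_derive1_comp df dg). Qed.

Lemma der_shift f c x a : is_derive (x + c) 1 f a -> is_derive x 1 (fun y => f (y + c)) a.
Proof.
move=> df; apply: (der_comp (b := 1) (f := f) (g := fun y => y + c) df); last by rewrite mulr1.
by apply: (derD (is_derive_id x 1) (is_derive_cst c x 1)); rewrite addr0.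
Qed.

Lemma contD f g : continuous f -> continuous g -> continuous (fun x => f x + g x).
Proof. by move=> cf cg x; apply: continuousD; [exact: cf|exact: cg]. Qed.

Lemma contB f g : continuous f -> continuous g -> continuous (fun x => f x - g x).
Proof. by move=> cf cg x; apply: continuousB; [exact: cf|exact: cg]. Qed.

Lemma contM f g : continuous f -> continuous g -> continuous (fun x => f x * g x).
Proof. by move=> cf cg x; apply: continuousM; [exact: cf|exact: cg]. Qed.

Lemma contZ c f : continuous f -> continuous (fun x => c * f x).
Proof. by move=> cf; apply: contM cf => x; exact: cst_continuous. Qed.

Lemma prim_FTC F f : (forall x, is_derive x 1 F (f x)) -> continuous f ->
  forall x y, prim f y - prim f x = F y - F x.
Proof.
move=> dF cf x y; have lf := continuous_lbm cf.
suff H : F y - prim f y = F x - prim f x by lra.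
apply: (@zero_derive_cst (F \- prim f)) => z.
by apply: derB (dF z) (is_derive_prim lf (cf z)) _; rewrite subrr.
Qed.

Lemma derive_nondecr F f a b : a <= b ->
  (forall x, a <= x <= b -> is_derive x 1 F (f x)) -> 
  (forall x, a <= x <= b -> 0 <= f x) -> F a <= F b.
Proof.
move=> ab dF f0.
have [||c cab H] := @MVT_segment R F f a b ab.
- by move=> x; rewrite in_itv/= => /andP[? ?]; apply: dF; rewrite !ltW.
- apply: derivable_within_continuous => x; rewrite in_itv/= => xab.
  by have [] := dF _ xab.
move: cab; rewrite in_itv/= => cab; rewrite -subr_ge0 H.
by rewrite mulr_ge0 ?f0 ?subr_ge0.
Qed.

End Calculus.

(** * The Green operator of 4 + d^2/dx^2 on periodic functions *)

Section Periodic.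
Context {R : realType}.
Implicit Types (f g : R -> R) (L x y z : R).

Definition has_period L f := forall x, f (x + L) = f x.

Lemma has_periodn L f n x : has_period L f -> f (x + n%:R * L) = f x.
Proof.
move=> pf; elim: n => [|n IH]; first by rewrite mul0r addr0.
by rewrite -addn1 natrD mulrDl mul1r addrA pf.
Qed.

Lemma has_periodz L f (k : int) x : has_period L f -> f (x + k%:~R * L) = f x.
Proof.
move=> pf; case: k => n; first exact: has_periodn.
rewrite NegzE mulrNz mulNr -[in RHS](subrK (n.+1%:R * L) x).
by rewrite has_periodn.
Qed.

Lemma periodic_reduce L f z x : 0 < L -> has_period L f ->
  exists2 y, z <= y <= z + L & f y = f x.
Proof.
move=> L0 pf; pose k := Num.floor ((x - z) / L).
exists (x + (- k)%:~R * L); last exact: has_periodz.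
have /andP[k1 k2] := floor_itv ((x - z) / L).
rewrite -/k in k1 k2; rewrite intrN mulNr.
move: k1 k2; rewrite ler_pdivlMr// ltr_pdivrMr// intrD mulrDl mul1r => k1 k2.
by apply/andP; split; [lra|apply: ltW; lra].
Qed.

Lemma periodic_bounded L f : 0 < L -> has_period L f -> continuous f ->
  exists M, forall x, `|f x| <= M.
Proof.
move=> L0 pf /continuous_lbm[_ /(_ L)[M HM]]; exists M => x.
have [y /andP[y0 yL] <-] := periodic_reduce 0 x L0 pf.
by apply: HM; rewrite ger0_norm//; lra.
Qed.

Lemma derive1_periodic L f : (forall x, derivable f x 1) -> has_period L f ->
  has_period L (derive1 f).
Proof.
move=> df pf x; apply/esym.
have d1 : is_derive x 1 (fun y => f (y + L)) (derive1 f (x + L)).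
  by apply: der_shift; rewrite derive1E; apply: derivableP.
have fE : (fun y => f (y + L)) = f by apply/funext.
rewrite fE in d1.
by rewrite [LHS]derive1E (@derive_val _ _ _ _ _ _ _ d1).
Qed.

End Periodic.

(** * The explicit Green kernel: equation, inversion, positivity *)

Section Elliptic.
Context {R : realType}.
Notation mu := (@lebesgue_measure R).
Variable L : R.
Hypothesis L0 : 0 < L.
Hypothesis Lpi : L <= pi / 2.
Implicit Types (f g G : R -> R) (x y z a M : R).

Let sinL : 0 < sin L.
Proof. by apply: sin_gt0_pi; rewrite L0/= (le_lt_trans Lpi)//; have := pi_gt0 R; lra. Qed.

Let kap := (4 * sin L)^-1.
Let kap0 : 0 < kap. Proof. by rewrite invr_gt0 mulr_gt0. Qed.
Let kapE : 4 * kap * sin L = 1.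
Proof. by rewrite /kap; field; rewrite gt_eqF. Qed.

Let cos2 x := cos (2 * x).
Let sin2 x := sin (2 * x).
Let C f x := prim (cos2 \* f) (x + L) - prim (cos2 \* f) x.
Let S f x := prim (sin2 \* f) (x + L) - prim (sin2 \* f) x.

(* [Kop f x = int_x^(x+L) cos (2 (y - x) - L) / (4 sin L) f y dy], with the
   Green kernel of [4 + d^2/dx^2] on [L]-periodic functions, expanded by the
   addition formula; [Kop1 f] is its derivative. *)
Definition Kop f x := kap * (cos (2 * x + L) * C f x + sin (2 * x + L) * S f x).
Definition Kop1 f x :=
  kap * 2 * (cos (2 * x + L) * S f x - sin (2 * x + L) * C f x).

Let d_lin b x : is_derive x 1 (fun y : R => 2 * y + b) 2.
Proof.
apply: (derD (a := 2) (b := 0)); last by rewrite addr0.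
by apply: derZ (is_derive_id _ _) _; rewrite mulr1.
Qed.

Let d_cos b x : is_derive x 1 (fun y : R => cos (2 * y + b)) (- 2 * sin (2 * x + b)).
Proof.
by apply: (der_comp (f := @cos R) (is_derive_cos _) (d_lin b x)); ring.
Qed.

Let d_sin b x : is_derive x 1 (fun y : R => sin (2 * y + b)) (2 * cos (2 * x + b)).
Proof.
by apply: (der_comp (f := @sin R) (is_derive_sin _) (d_lin b x)); ring.
Qed.

Let d_cos2 x : is_derive x 1 cos2 (- 2 * sin2 x).
Proof.
have := d_cos 0 x; rewrite addr0 -/(sin2 x) (_ : (fun _ => _) = cos2)//.
by apply/funext => y; rewrite addr0.
Qed.

Let d_sin2 x : is_derive x 1 sin2 (2 * cos2 x).
Proof.
have := d_sin 0 x; rewrite addr0 -/(cos2 x) (_ : (fun _ => _) = sin2)//.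
by apply/funext => y; rewrite addr0.
Qed.

Let c_cos2 : continuous cos2.
Proof. by move=> x; apply: is_derive_continuous (d_cos2 x). Qed.
Let c_sin2 : continuous sin2.
Proof. by move=> x; apply: is_derive_continuous (d_sin2 x). Qed.

Let lbm_cos2 f : lbm f -> lbm (cos2 \* f).
Proof. by apply: lbmM; exact: continuous_lbm. Qed.
Let lbm_sin2 f : lbm f -> lbm (sin2 \* f).
Proof. by apply: lbmM; exact: continuous_lbm. Qed.

Let d_C f x : continuous f -> has_period L f ->
  is_derive x 1 (C f) (f x * (cos2 (x + L) - cos2 x)).
Proof.
move=> cf pf; have cc : continuous (cos2 \* f).
  by move=> y; apply: continuousM; [exact: c_cos2|exact: cf].
have lc := continuous_lbm cc.
apply: derB (der_shift (is_derive_prim lc (cc (x + L)))) (is_derive_prim lc (cc x)) _.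
by rewrite /= pf; ring.
Qed.

Let d_S f x : continuous f -> has_period L f ->
  is_derive x 1 (S f) (f x * (sin2 (x + L) - sin2 x)).
Proof.
move=> cf pf; have cc : continuous (sin2 \* f).
  by move=> y; apply: continuousM; [exact: c_sin2|exact: cf].
have lc := continuous_lbm cc.
apply: derB (der_shift (is_derive_prim lc (cc (x + L)))) (is_derive_prim lc (cc x)) _.
by rewrite /= pf; ring.
Qed.

(** The phases 2 (x + L) and 2 x at the two ends of the window are 2 x + L plus and minus [L].
    Expanded around this centre, the boundary terms below reduce to ring identities. *)
Let trig x : [/\ cos2 (x + L) = cos (2 * x + L) * cos L - sin (2 * x + L) * sin L,
  cos2 x = cos (2 * x + L) * cos L + sin (2 * x + L) * sin L,
  sin2 (x + L) = sin (2 * x + L) * cos L + cos (2 * x + L) * sin L &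
  sin2 x = sin (2 * x + L) * cos L - cos (2 * x + L) * sin L].
Proof.
rewrite -cosD -cosB -sinD -sinB /cos2 /sin2.
by split; congr (_ _); ring.
Qed.

Let pyth x : cos x ^+ 2 + sin x ^+ 2 = 1. Proof. exact: cos2Dsin2. Qed.

(** The kernel takes the same value at both ends of the window and [f] is periodic, so the boundary
    terms cancel and only the derivative of the kernel remains. *)
Lemma is_derive_Kop f x : continuous f -> has_period L f ->
  is_derive x 1 (Kop f) (Kop1 f x).
Proof.
move=> cf pf; apply: derZ.
  apply: derD (derM (d_cos L x) (d_C x cf pf) erefl) (derM (d_sin L x) (d_S x cf pf) erefl) erefl.
have [-> -> -> ->] := trig x.
rewrite /Kop1; ring.
Qed.

(** The derivative of the kernel jumps by 4 kap sin L = 1 across the period, which produces the term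
    [f x] and explains the normalisation of [kap]. *)
Lemma is_derive_Kop1 f x : continuous f -> has_period L f ->
  is_derive x 1 (Kop1 f) (f x - 4 * Kop f x).
Proof.
move=> cf pf; apply: derZ.
  apply: derB (derM (d_cos L x) (d_S x cf pf) erefl) (derM (d_sin L x) (d_C x cf pf) erefl) erefl.
have [-> -> -> ->] := trig x.
have p := pyth (2 * x + L).
rewrite /Kop; transitivity (f x * (4 * kap * sin L) * (cos (2 * x + L) ^+ 2 + sin (2 * x + L) ^+ 2) - 4 * Kop f x).
  by rewrite p kapE !mulr1.
by rewrite /Kop; ring.
Qed.

Let prim_shift h x y : continuous h ->
  prim h (y + L) - prim h (x + L) =
  prim (fun z => h (z + L)) y - prim (fun z => h (z + L)) x.
Proof.
move=> ch; have chL : continuous (fun z => h (z + L)).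
  move=> z; apply: (@continuous_comp R R R (fun z => z + L) h); last exact: ch.
  apply: is_derive_continuous; exact: der_shift (is_derive_id _ _).
apply/esym/(@prim_FTC R (fun z => prim h (z + L))) => // z.
by apply: der_shift; apply: is_derive_prim; [exact: continuous_lbm|exact: ch].
Qed.

(** Translation by [L] rotates both (C, S) and (cos, sin)(2 x + L) by the angle 2 L, and [Kop] is a
    multiple of their scalar product. *)
Lemma Kop_periodic f : continuous f -> has_period L f -> has_period L (Kop f).
Proof.
move=> cf pf x; have lf := continuous_lbm cf.
have cc : continuous (cos2 \* f).
  by move=> y; apply: continuousM; [exact: c_cos2|exact: cf].
have cs : continuous (sin2 \* f).
  by move=> y; apply: continuousM; [exact: c_sin2|exact: cf].
have cos2L y : cos2 (y + L) = cos (2 * L) * cos2 y - sin (2 * L) * sin2 y.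
  by rewrite /cos2 /sin2 mulrDr cosD; ring.
have sin2L y : sin2 (y + L) = cos (2 * L) * sin2 y + sin (2 * L) * cos2 y.
  by rewrite /cos2 /sin2 mulrDr sinD; ring.
have -> : Kop f (x + L) = kap *
    (cos (2 * x + L + 2 * L) * (cos (2 * L) * C f x - sin (2 * L) * S f x) +
     sin (2 * x + L + 2 * L) * (cos (2 * L) * S f x + sin (2 * L) * C f x)).
  have e : 2 * (x + L) + L = 2 * x + L + 2 * L by ring.
  have lC := lbm_cos2 lf; have lS := lbm_sin2 lf.
  rewrite /Kop e; congr (kap * (_ * _ + _ * _)).
  - rewrite /C prim_shift// (_ : (fun _ => _) =
      (fun y => cos (2 * L) * (cos2 \* f) y) \- (fun y => sin (2 * L) * (sin2 \* f) y)).
      by rewrite !primBf ?primZ//; [rewrite /S; ring|exact: lbmZ..].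
    by apply/funext => y /=; rewrite pf cos2L; ring.
  - rewrite /S prim_shift// (_ : (fun _ => _) =
      (fun y => cos (2 * L) * (sin2 \* f) y) \+ (fun y => sin (2 * L) * (cos2 \* f) y)).
      by rewrite !primD ?primZ//; [rewrite /C; ring|exact: lbmZ..].
    by apply/funext => y /=; rewrite pf sin2L; ring.
have p := pyth (2 * L).
transitivity (Kop f x * (cos (2 * L) ^+ 2 + sin (2 * L) ^+ 2)); last by rewrite p mulr1.
by rewrite (cosD (2 * x + L)) (sinD (2 * x + L)) /Kop; ring.
Qed.

Lemma KopB f g x : lbm f -> lbm g -> Kop (f \- g) x = Kop f x - Kop g x.
Proof.
move=> lf lg; rewrite /Kop /C /S.
have -> : cos2 \* (f \- g) = (cos2 \* f) \- (cos2 \* g).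
  by apply/funext => y /=; ring.
have -> : sin2 \* (f \- g) = (sin2 \* f) \- (sin2 \* g).
  by apply/funext => y /=; ring.
by rewrite !primBf; [ring|try exact: lbm_cos2; exact: lbm_sin2..].
Qed.

Lemma Kop1B f g x : lbm f -> lbm g -> Kop1 (f \- g) x = Kop1 f x - Kop1 g x.
Proof.
move=> lf lg; rewrite /Kop1 /C /S.
have -> : cos2 \* (f \- g) = (cos2 \* f) \- (cos2 \* g).
  by apply/funext => y /=; ring.
have -> : sin2 \* (f \- g) = (sin2 \* f) \- (sin2 \* g).
  by apply/funext => y /=; ring.
by rewrite !primBf; [ring|try exact: lbm_cos2; exact: lbm_sin2..].
Qed.

Let boundCS f x : lbm f -> 0 <= x <= L ->
  `|C f x| <= prim (fun y => `|f y|) (2 * L) /\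
  `|S f x| <= prim (fun y => `|f y|) (2 * L).
Proof.
move=> lf /andP[x0 xL]; have la := lbm_norm lf.
have H (h : R -> R) : lbm h -> (forall y, `|h y| <= `|f y|) ->
    `|prim h (x + L) - prim h x| <= prim (fun y => `|f y|) (2 * L).
  move=> lh hf; have xxL : x <= x + L by lra.
  apply: (le_trans (prim_norm_le lh xxL)).
  apply: (@le_trans _ _ (prim (fun y => `|f y|) (x + L) - prim (fun y => `|f y|) x)).
    by apply: le_prim => //; exact: lbm_norm.
  rewrite -[leRHS]subr0; apply: lerB; first by apply: prim_homo => //; lra.
  by rewrite -(prim0 (fun y => `|f y|)); apply: prim_homo.
split; apply: H; [exact: lbm_cos2| |exact: lbm_sin2|] => y /=; rewrite normrM ler_piMl//.
- by rewrite ler_norml cos_geN1 cos_le1.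
- by rewrite ler_norml sin_geN1 sin_le1.
Qed.

Let sum2_bound (x c s B : R) : `|c| <= B -> `|s| <= B -> 
  `|cos x * c + sin x * s| <= 2 * B /\ `|cos x * s - sin x * c| <= 2 * B.
Proof.
move=> cB sB; have C1 : `|cos x| <= 1 by rewrite ler_norml cos_geN1 cos_le1.
have S1 : `|sin x| <= 1 by rewrite ler_norml sin_geN1 sin_le1.
have H (y d : R) : `|y| <= 1 -> `|d| <= B -> `|y * d| <= B.
  by move=> y1 dB; rewrite normrM -[leRHS]mul1r ler_pM.
rewrite mulrDl mul1r; split.
  by apply: (le_trans (ler_normD _ _)); apply: lerD; exact: H.
by apply: (le_trans (ler_normB _ _)); apply: lerD; exact: H.
Qed.

(** For [x] in [0, L] every window [x, x + L] lies in [0, 2 L]. The bound is by an L^1 norm because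
    the vorticity is continuous in time only in L^1. *)
Lemma Kop_bound f x : lbm f -> 0 <= x <= L ->
  `|Kop f x| <= (2 * sin L)^-1 * prim (fun y => `|f y|) (2 * L) /\
  `|Kop1 f x| <= (sin L)^-1 * prim (fun y => `|f y|) (2 * L).
Proof.
move=> lf xL; have [cB sB] := boundCS lf xL.
have [H1 H2] := sum2_bound (2 * x + L) cB sB.
have k2 : (2 * sin L)^-1 = kap * 2 by rewrite /kap; field; rewrite gt_eqF.
have k4 : (sin L)^-1 = kap * 4 by rewrite /kap; field; rewrite gt_eqF.
split.
- by rewrite /Kop normrM (gtr0_norm kap0) k2 -mulrA ler_wpM2l// ltW.
- have kk : 0 <= kap * 2 by rewrite mulr_ge0 ?(ltW kap0).
  rewrite /Kop1 normrM ger0_norm// k4 (_ : kap * 4 = kap * 2 * 2); last by ring.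
  by rewrite -(mulrA (kap * 2)) ler_wpM2l.
Qed.

(** For discontinuous [g] the operator cannot be differentiated as above. Instead g = G'' + 4 G is
    integrated by parts twice against cos 2x and sin 2x, which expresses [C g] and [S g] by boundary
    values of [G] and [G1]. *)
Lemma Kop_green (g G G1 : R -> R) M : lbm g -> (forall x, `|g x| <= M) ->
  has_period L G -> has_period L G1 -> (forall x, is_derive x 1 G (G1 x)) -> continuous G1 ->
  (forall x y, G1 y - G1 x = prim (fun z => g z - 4 * G z) y - prim (fun z => g z - 4 * G z) x) ->
  forall x, Kop g x = G x /\ Kop1 g x = G1 x.
Proof.
move=> lg gM pG pG1 dG cG1 eG.
have cG : continuous G by move=> y; exact: is_derive_continuous (dG y).
have [MG HG] := periodic_bounded L0 pG cG.
have [MG1 HG1] := periodic_bounded L0 pG1 cG1.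
have M0 : 0 <= M by rewrite (le_trans _ (gM 0)).
have MG0 : 0 <= MG by rewrite (le_trans _ (HG 0)).
have MG10 : 0 <= MG1 by rewrite (le_trans _ (HG1 0)).
have lh : lbm (fun z => g z - 4 * G z).
  by apply: lbmB => //; apply: lbmZ; exact: continuous_lbm.
pose B := M + 4 * MG + MG1 + 2.
have hB x : `|g x - 4 * G x| <= B.
  rewrite (le_trans (ler_normB _ _))// normrM ger0_norm//.
  have := gM x; have := HG x; rewrite /B; lra.
have parts (u u1 : R -> R) : (forall y, is_derive y 1 u (u1 y)) -> continuous u1 ->
    (forall y, `|u1 y| <= 2) -> forall x y,
    u y * G1 y - u x * G1 x = prim (fun t => u1 t * G1 t + u t * (g t - 4 * G t)) y
      - prim (fun t => u1 t * G1 t + u t * (g t - 4 * G t)) x.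
  move=> du cu1 bu1.
  have cu : continuous u by move=> y; exact: is_derive_continuous (du y).
  apply: (@prim_parts _ _ _ _ _ B) => //; try exact: continuous_lbm.
  - by move=> y; rewrite (le_trans (bu1 y))// /B; lra.
  - by move=> x y; rewrite (prim_FTC du cu1).
have partsG (u u1 : R -> R) : (forall y, is_derive y 1 u (u1 y)) -> continuous u1 ->
    forall x y, u y * G y - u x * G x =
      prim (fun t => u1 t * G t + u t * G1 t) y - prim (fun t => u1 t * G t + u t * G1 t) x.
  move=> du cu1 x y.
  have cu : continuous u by move=> z; exact: is_derive_continuous (du z).
  apply/esym/(@prim_FTC R (u \* G) (fun t => u1 t * G t + u t * G1 t)) => z.
    by apply: derM (du z) (dG z) _.
  by apply: contD; apply: contM.
have lG := continuous_lbm cG; have lG1 := continuous_lbm cG1.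
have csin : continuous (fun y => - 2 * sin2 y).
  exact: contZ.
have ccos : continuous (fun y => 2 * cos2 y).
  exact: contZ.
have bsin y : `|- 2 * sin2 y| <= 2.
  rewrite normrM normrN normr_nat ler_piMr// ler_norml.
  by rewrite sin_geN1 sin_le1.
have bcos y : `|2 * cos2 y| <= 2.
  rewrite normrM normr_nat ler_piMr// ler_norml.
  by rewrite cos_geN1 cos_le1.
have lc := continuous_lbm c_cos2; have ls := continuous_lbm c_sin2.
(* Formally (cos2 G' + 2 sin2 G)' = cos2 (G'' + 4 G) = cos2 g; [SE] is the analogue for sin2. *)
have CE x : C g x = cos2 (x + L) * G1 (x + L) - cos2 x * G1 x
    + 2 * (sin2 (x + L) * G (x + L) - sin2 x * G x).
  rewrite (parts _ _ d_cos2)// (partsG _ _ d_sin2)//.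
  have E : cos2 \* g = (fun t => -2 * sin2 t * G1 t + cos2 t * (g t - 4 * G t)) \+
      (fun y => 2 * (2 * cos2 y * G y + sin2 y * G1 y)).
    by apply/funext => y /=; ring.
  have l1 : lbm (fun t => -2 * sin2 t * G1 t + cos2 t * (g t - 4 * G t)).
    by apply: lbmD; apply: lbmM => //; exact: lbmZ.
  have l2 : lbm (fun y => 2 * cos2 y * G y + sin2 y * G1 y).
    by apply: lbmD; apply: lbmM => //; exact: lbmZ.
  by rewrite /C E !(primD _ l1 (lbmZ 2 l2)) !(primZ _ _ l2); ring.
have SE x : S g x = sin2 (x + L) * G1 (x + L) - sin2 x * G1 x
    - 2 * (cos2 (x + L) * G (x + L) - cos2 x * G x).
  rewrite (parts _ _ d_sin2)// (partsG _ _ d_cos2)//.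
  have E : sin2 \* g = (fun t => 2 * cos2 t * G1 t + sin2 t * (g t - 4 * G t)) \-
      (fun y => 2 * (-2 * sin2 y * G y + cos2 y * G1 y)).
    by apply/funext => y /=; ring.
  have l1 : lbm (fun t => 2 * cos2 t * G1 t + sin2 t * (g t - 4 * G t)).
    by apply: lbmD; apply: lbmM => //; exact: lbmZ.
  have l2 : lbm (fun y => -2 * sin2 y * G y + cos2 y * G1 y).
    by apply: lbmD; apply: lbmM => //; exact: lbmZ.
  by rewrite /S E !(primBf _ l1 (lbmZ 2 l2)) !(primZ _ _ l2); ring.
move=> x; have p := pyth (2 * x + L).
have [e1 e2 e3 e4] := trig x.
split.
- transitivity (G x * (4 * kap * sin L) * (cos (2 * x + L) ^+ 2 + sin (2 * x + L) ^+ 2)).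
    by rewrite /Kop CE SE pG pG1 e1 e2 e3 e4; ring.
  by rewrite p kapE !mulr1.
- transitivity (G1 x * (4 * kap * sin L) * (cos (2 * x + L) ^+ 2 + sin (2 * x + L) ^+ 2)).
    by rewrite /Kop1 CE SE pG pG1 e1 e2 e3 e4; ring.
  by rewrite p kapE !mulr1.
Qed.

Let kerf x y := kap * cos (2 * (y - x) - L).

Let Kop_ker f x : lbm f ->
  Kop f x = prim (fun y => kerf x y * f y) (x + L) - prim (fun y => kerf x y * f y) x.
Proof.
move=> lf; have lC := lbm_cos2 lf; have lS := lbm_sin2 lf.
rewrite (_ : (fun _ => _) = (fun y => (kap * cos (2 * x + L)) * (cos2 \* f) y)
   \+ (fun y => (kap * sin (2 * x + L)) * (sin2 \* f) y)).
  by rewrite !primD ?primZ//; [rewrite /Kop /C /S; ring|exact: lbmZ..].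
apply/funext => y /=; rewrite /kerf /cos2 /sin2.
by rewrite (_ : 2 * (y - x) - L = 2 * y - (2 * x + L)) ?cosB; ring.
Qed.

Let lbm_kerf f x : lbm f -> lbm (fun y => kerf x y * f y).
Proof.
move=> lf; rewrite (_ : (fun _ => _) = (fun y => (kap * cos (2 * x + L)) * (cos2 \* f) y)
   \+ (fun y => (kap * sin (2 * x + L)) * (sin2 \* f) y)).
  by apply: lbmD; apply: lbmZ; [exact: lbm_cos2|exact: lbm_sin2].
apply/funext => y /=; rewrite /kerf /cos2 /sin2.
by rewrite (_ : 2 * (y - x) - L = 2 * y - (2 * x + L)) ?cosB; ring.
Qed.

(* This is where [L <= pi / 2], i.e. [m >= 4], is needed. *)
Let kerf_ge0 x y : x <= y <= x + L -> 0 <= kerf x y.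
Proof.
move=> /andP[xy yx]; rewrite mulr_ge0 ?(ltW kap0)// cos_ge0_pihalf//.
have H := Lpi; by apply/andP; split; lra.
Qed.

Lemma Kop_ge0 f x : lbm f -> (forall y, 0 <= f y) -> 0 <= Kop f x.
Proof.
move=> lf f0; rewrite Kop_ker//; have l0 := L0; apply: prim_ge0; [exact: lbm_kerf|lra|].
by move=> t xt; rewrite mulr_ge0// kerf_ge0.
Qed.

(** When L = pi / 2 the kernel vanishes at the ends of the window, so only the middle third of
    [p, p + r] is used. There |2 (y - x) - L| <= L - 2 r / 3, and the kernel is bounded below by a
    constant depending on [r] alone. *)
Lemma Kop_lower r : 0 < r -> r <= L -> exists2 c, 0 < c &
  forall f a x p, lbm f -> (forall y, 0 <= f y) -> 0 <= a ->
    x <= p -> p + r <= x + L -> (forall y, p <= y <= p + r -> a <= f y) ->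
    c * a <= Kop f x.
Proof.
move=> r0 rL; have l0 := L0; have lpi := Lpi.
pose c := kap * cos (L - 2 * (r / 3)).
have c0 : 0 < c.
  rewrite mulr_gt0// cos_gt0_pihalf//; apply/andP; split; have := pi_gt0 R; lra.
exists (c * (r / 3)); first by rewrite mulr_gt0 ?divr_gt0.
move=> f a x p lf f0 a0 xp pxL fa.
have lk := lbm_kerf x lf.
have mono u v : x <= u -> u <= v -> v <= x + L ->
    prim (fun y => kerf x y * f y) u <= prim (fun y => kerf x y * f y) v.
  move=> xu uv vx; rewrite -subr_ge0; apply: prim_ge0 => //.
  by move=> t /andP[ut tv]; rewrite mulr_ge0// kerf_ge0//; apply/andP; split; lra.
pose u := p + r / 3; pose v := p + 2 * (r / 3).
have uv : c * (r / 3) * a <= prim (fun y => kerf x y * f y) v - prim (fun y => kerf x y * f y) u.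
  rewrite (_ : c * (r / 3) * a = prim (fun=> c * a) v - prim (fun=> c * a) u); last first.
    by rewrite !prim_cst /u /v; field.
  apply: le_prim => //; [exact: lbm_cst|rewrite /u /v; lra|].
  move=> t /andP[ut tv]; rewrite ler_pM ?(ltW c0)//; last first.
    by apply: fa; rewrite /u /v in ut tv; apply/andP; split; lra.
  rewrite /c /kerf ler_pM2l//.
  have cos_anti b d : 0 <= b -> b <= d -> d <= pi -> cos d <= cos b.
    move=> b0 bd dp; rewrite leNgt ltr_cos -?leNgt// in_itv/=; apply/andP; split=> //.
      exact: le_trans bd.
    exact: le_trans dp.
  have p0 := pi_gt0 R; rewrite /u /v in ut tv.
  have [d0|d0] := leP 0 (2 * (t - x) - L); first by apply: cos_anti; lra.
  by rewrite -(cosN (2 * (t - x) - L)); apply: cos_anti; lra.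
apply: (le_trans uv); rewrite Kop_ker// lerB// mono ?/u ?/v//; lra.
Qed.

End Elliptic.

(** * Absolute continuity and time-dependent fields *)

Section AbsolutelyContinuous.
Context {R : realType}.
Implicit Types (a b c f u v : R -> R) (x y : R).

Lemma cont_zero f (a b : R) : continuous f -> (forall x, a <= x <= b -> 0 <= f x) ->
  prim f b = prim f a -> forall x, a < x < b -> f x = 0.
Proof.
move=> cf f0 fab x /andP[ax xb]; have lf := continuous_lbm cf.
apply/eqP; rewrite eq_le f0 ?andbT; last by rewrite !ltW.
rewrite leNgt; apply/negP => fx.
have /continuous_at_epsP/(_ (f x / 2))[|d d0 Hd] := cf x; first by rewrite divr_gt0.
(* Length of an interval to the right of [x] that stays inside [a, b] and on which [f] is at least f
   x / 2. *)
pose r := Num.min (d / 2) (b - x).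
have r0 : 0 < r by rewrite lt_min divr_gt0//= subr_gt0.
have rd : r < d by rewrite gt_min; apply/orP; left; lra.
have rb : r <= b - x by rewrite ge_min lexx orbT.
have p1 : 0 <= prim f x - prim f a.
  by apply: prim_ge0 => //; [exact: ltW|move=> t /andP[t1 t2]; apply: f0; apply/andP; split; lra].
have p2 : 0 <= prim f b - prim f (x + r).
  by apply: prim_ge0 => //; [lra|move=> t /andP[t1 t2]; apply: f0; apply/andP; split; lra].
have p3 : prim (fun=> f x / 2) (x + r) - prim (fun=> f x / 2) x <= prim f (x + r) - prim f x.
  apply: le_prim => //; [exact: lbm_cst|lra|].
  move=> t /andP[t1 t2]; have td : `|t - x| < d by rewrite ger0_norm; lra.
  by have := Hd t td; rewrite ler_norml => /andP[? ?]; lra.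
rewrite !prim_cst in p3.
have : 0 < f x / 2 * r by rewrite mulr_gt0// divr_gt0.
lra.
Qed.

Lemma derive_lipschitz f (f1 : R -> R) (C : R) : (forall x, is_derive x 1 f (f1 x)) ->
  (forall x, `|f1 x| <= C) -> forall x y, `|f y - f x| <= C * `|y - x|.
Proof.
move=> df fC x y; wlog xy : x y / x <= y => [H|].
  have [/H//|/ltW/H] := leP x y; by rewrite distrC [X in _ <= _ * X]distrC.
have [|c _ ->] := @MVT_segment R f f1 x y xy (fun z _ => df z).
  by apply: continuous_subspaceT => z; exact: is_derive_continuous (df z).
by rewrite normrM ler_wpM2r.
Qed.

(** The space W^{1,oo}: [a] is a representative of the weak derivative of [u], known only through
    its primitive. *)
Definition abs_cont u a := [/\ continuous u, lbm a, exists M : R, forall x, `|u x| <= M /\ `|a x| <= M &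
  forall x y, u y - u x = prim a y - prim a x].

Lemma abs_cont_C1 u a : (forall x, is_derive x 1 u (a x)) -> continuous a ->
  (exists M : R, forall x, `|u x| <= M) -> (exists M : R, forall x, `|a x| <= M) -> abs_cont u a.
Proof.
move=> du ca [M1 H1] [M2 H2]; split.
- by move=> x; exact: is_derive_continuous (du x).
- exact: continuous_lbm.
- by exists (Num.max M1 M2) => x; rewrite !le_max H1 H2 orbT.
- by move=> x y; rewrite (prim_FTC du ca).
Qed.

Lemma abs_contM u a v b : abs_cont u a -> abs_cont v b ->
  abs_cont (fun x => u x * v x) (fun x => a x * v x + u x * b x).
Proof.
move=> [cu la [M1 H1] ua] [cv lb [M2 H2] vb].
have lu := continuous_lbm cu; have lv := continuous_lbm cv.
pose M := Num.max M1 M2.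
have uM x : `|u x| <= M by rewrite le_max; have [-> _] := H1 x.
have aM x : `|a x| <= M by rewrite le_max; have [_ ->] := H1 x.
have vM x : `|v x| <= M by rewrite le_max; have [-> _] := H2 x; rewrite orbT.
have bM x : `|b x| <= M by rewrite le_max; have [_ ->] := H2 x; rewrite orbT.
split.
- exact: contM.
- by apply: lbmD; exact: lbmM.
- exists (M * M + M * M) => x; split.
    by rewrite normrM ler_wpDr ?mulr_ge0 ?(le_trans _ (uM 0))// ler_pM.
  by apply: (le_trans (ler_normD _ _)); apply: lerD; rewrite normrM ler_pM.
- exact: (@prim_parts _ a b u v M).
Qed.

Lemma abs_contD u a v b : abs_cont u a -> abs_cont v b ->
  abs_cont (fun x => u x + v x) (fun x => a x + b x).
Proof.
move=> [cu la [M1 H1] ua] [cv lb [M2 H2] vb]; split.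
- exact: contD.
- exact: lbmD.
- exists (M1 + M2) => x; have [? ?] := H1 x; have [? ?] := H2 x.
  by split; apply: (le_trans (ler_normD _ _)); exact: lerD.
- by move=> x y; rewrite !(primD _ la lb); have := ua x y; have := vb x y; lra.
Qed.

Lemma abs_contZ (c : R) u a : abs_cont u a ->
  abs_cont (fun x => c * u x) (fun x => c * a x).
Proof.
move=> [cu la [M1 H1] ua]; split.
- exact: contZ.
- exact: lbmZ.
- exists (`|c| * M1) => x; have [? ?] := H1 x.
  by rewrite !normrM; split; apply: ler_wpM2l.
- by move=> x y; rewrite !(primZ _ _ la) -!mulrBr ua.
Qed.

End AbsolutelyContinuous.

(** * Fields bounded and Lipschitz in space, continuous in time *)

Section Nice.
Context {R : realType}.
Implicit Types (k l : R -> R -> R) (f Z X : R -> R) (t s x y : R).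

(** The regularity shared by [G], [G'], [H], [H'] and their products. Continuity in time is uniform
    in space, which is what allows passing to limits under integrals in [x] and along
    trajectories. *)
Definition regfield k := [/\ exists M : R, forall t x, `|k t x| <= M,
  exists C : R, forall t x y, `|k t y - k t x| <= C * `|y - x| &
  forall s (e : R), 0 < e -> exists2 d : R, 0 < d & forall t, `|t - s| < d ->
    forall x, `|k t x - k s x| <= e].

Lemma regfield_bound k : regfield k -> exists2 M : R, 0 < M & forall t x, `|k t x| <= M.
Proof.
case=> [[M HM] _ _]; exists (`|M| + 1); first by rewrite ltr_pwDr.
by move=> t x; rewrite (le_trans (HM t x))// (le_trans (ler_norm M))// lerDl.
Qed.

Lemma regfield_lip k : regfield k -> exists2 C : R, 0 < C & forall t x y, `|k t y - k t x| <= C * `|y - x|.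
Proof.
case=> [_ [M HM] _]; exists (`|M| + 1); first by rewrite ltr_pwDr.
move=> t x y; rewrite (le_trans (HM t x y))// ler_wpM2r//.
by rewrite (le_trans (ler_norm M))// lerDl.
Qed.

Lemma regfield_cont_space k t : regfield k -> continuous (k t).
Proof.
move=> /regfield_lip[C C0 HC] x; apply/continuous_at_epsP => e e0.
exists (e / C); first exact: divr_gt0.
move=> y yx; apply: (le_trans (HC t x y)).
by move: yx; rewrite ltr_pdivlMr// mulrC => /ltW.
Qed.

Lemma regfield_cont_path k X : regfield k -> continuous X -> continuous (fun t => k t (X t)).
Proof.
move=> nk cX s; have [C C0 HC] := regfield_lip nk; have [_ _ tk] := nk.
apply/continuous_at_epsP => e e0.
have [|d1 d10 H1] := tk s (e / 2); first exact: divr_gt0.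
have /continuous_at_epsP/(_ (e / 2 / C))[|d2 d20 H2] := cX s; first by rewrite !divr_gt0.
exists (Num.min d1 d2); first by rewrite lt_min d10.
move=> t; rewrite lt_min => /andP[t1 t2].
rewrite (_ : _ - _ = (k t (X t) - k t (X s)) + (k t (X s) - k s (X s))); last by ring.
apply: (le_trans (ler_normD _ _)); rewrite [leRHS]splitr lerD//; last exact: H1.
apply: (le_trans (HC _ _ _)).
by have := H2 _ t2; rewrite ler_pdivlMr// mulrC.
Qed.

Lemma regfield_cont_time k x : regfield k -> continuous (fun t => k t x).
Proof. by move=> nk; apply: regfield_cont_path nk _ => ?; exact: cst_continuous. Qed.

Lemma regfieldD k l : regfield k -> regfield l -> regfield (fun t x => k t x + l t x).
Proof.
move=> [[M1 H1] [C1 L1] T1] [[M2 H2] [C2 L2] T2]; split.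
- by exists (M1 + M2) => t x; rewrite (le_trans (ler_normD _ _))// lerD.
- exists (C1 + C2) => t x y; rewrite mulrDl.
  rewrite (_ : _ - _ = (k t y - k t x) + (l t y - l t x)); last by ring.
  by rewrite (le_trans (ler_normD _ _))// lerD.
- move=> s e e0; have e20 : 0 < e / 2 by exact: divr_gt0.
  have [d1 d10 K1] := T1 s _ e20; have [d2 d20 K2] := T2 s _ e20.
  exists (Num.min d1 d2); first by rewrite lt_min d10.
  move=> t; rewrite lt_min => /andP[t1 t2] x.
  rewrite (_ : _ - _ = (k t x - k s x) + (l t x - l s x)); last by ring.
  by rewrite (le_trans (ler_normD _ _))// [leRHS]splitr lerD ?K1 ?K2.
Qed.

Lemma regfieldM k l : regfield k -> regfield l -> regfield (fun t x => k t x * l t x).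
Proof.
move=> nk nl; have [M1 M10 H1] := regfield_bound nk; have [M2 M20 H2] := regfield_bound nl.
have [C1 C10 L1] := regfield_lip nk; have [C2 C20 L2] := regfield_lip nl.
have [_ _ T1] := nk; have [_ _ T2] := nl.
have E t s x y : k t y * l t y - k s x * l s x =
  (k t y - k s x) * l t y + k s x * (l t y - l s x) by ring.
split.
- by exists (M1 * M2) => t x; rewrite normrM ler_pM.
- exists (C1 * M2 + M1 * C2) => t x y.
  rewrite E (le_trans (ler_normD _ _))// !normrM mulrDl lerD//.
    by rewrite mulrAC ler_pM.
  by rewrite -mulrA ler_pM.
- move=> s e e0.
  have [|d1 d10 K1] := T1 s (e / 2 / M2); first by rewrite !divr_gt0.
  have [|d2 d20 K2] := T2 s (e / 2 / M1); first by rewrite !divr_gt0.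
  exists (Num.min d1 d2); first by rewrite lt_min d10.
  move=> t; rewrite lt_min => /andP[t1 t2] x.
  rewrite E (le_trans (ler_normD _ _))// !normrM [leRHS]splitr lerD//.
    have -> : e / 2 = e / 2 / M2 * M2 by rewrite divfK ?gt_eqF.
    by apply: ler_pM => //; exact: K1.
  have -> : e / 2 = M1 * (e / 2 / M1) by rewrite [RHS]mulrC divfK ?gt_eqF.
  by apply: ler_pM => //; exact: K2.
Qed.

Lemma regfieldZ (c : R) k : regfield k -> regfield (fun t x => c * k t x).
Proof.
apply: (@regfieldM (fun _ _ => c)); split.
- by exists `|c|.
- by exists 0 => t x y; rewrite subrr normr0 mul0r.
- by move=> s e e0; exists 1 => // t _ x; rewrite subrr normr0 ltW.
Qed.

Lemma regfieldB k l : regfield k -> regfield l -> regfield (fun t x => k t x - l t x).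
Proof.
move=> nk nl; have := regfieldD nk (regfieldZ (-1) nl).
rewrite (_ : (fun _ _ => _) = (fun t x => k t x - l t x))//.
by apply/funext => t; apply/funext => x; rewrite mulN1r.
Qed.

Lemma regfield_lbm k t : regfield k -> lbm (k t).
Proof. by move=> nk; apply: continuous_lbm; exact: regfield_cont_space. Qed.

Lemma regfield_lbm_time k x : regfield k -> lbm (fun t => k t x).
Proof. by move=> nk; apply: continuous_lbm; exact: regfield_cont_time. Qed.

Lemma prim_bound0 f (C b : R) : lbm f -> (forall x, `|x| <= `|b| -> `|f x| <= C) ->
  `|prim f b| <= C * `|b|.
Proof.
move=> lf fC; rewrite -[prim f b]subr0 -(prim0 f) -{2}[b]subr0.
apply: prim_bound => // t /andP[t1 t2]; apply: fC.
by rewrite -[t]subr0 -[b]subr0 between_dist.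
Qed.

Lemma regfield_cont_int k f (b : R) : regfield k -> lbm f ->
  continuous (fun t => prim (fun x => k t x * f x) b).
Proof.
move=> nk lf s; have [_ _ T] := nk; have [_ /(_ `|b|)[M HM]] := lf.
have M0 : 0 <= M by rewrite (le_trans _ (HM 0 _)) ?normr0.
apply/continuous_at_epsP => e e0.
have b0 : 0 < (M + 1) * (`|b| + 1) by rewrite mulr_gt0 ?ltr_wpDl.
have [|d d0 K] := T s (e / ((M + 1) * (`|b| + 1))); first by rewrite divr_gt0.
exists d => // t ts.
have lk u : lbm (fun x => k u x * f x) by apply: lbmM => //; exact: regfield_lbm.
rewrite -primBf//.
have H : `|prim ((fun x => k t x * f x) \- (fun x => k s x * f x)) b| <=
    (e / ((M + 1) * (`|b| + 1)) * M) * `|b|.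
  apply: prim_bound0; first exact: lbmB.
  move=> x xb /=; rewrite -mulrBl normrM ler_pM//; [exact: K|exact: HM].
apply: (le_trans H).
rewrite -mulrA mulrAC ler_pdivrMr// ler_wpM2l ?(ltW e0)//.
by rewrite ler_pM// lerDl.
Qed.

Lemma regfield_prim_time_cont k t : regfield k -> continuous (fun x => prim (fun r => k r x) t).
Proof.
move=> nk x; have [C C0 HC] := regfield_lip nk.
apply/continuous_at_epsP => e e0; exists (e / (C * (`|t| + 1))).
  by rewrite divr_gt0// mulr_gt0// ltr_wpDl.
move=> y yx; rewrite -primBf; [|exact: regfield_lbm_time..].
have H : `|prim ((fun r => k r y) \- (fun r => k r x)) t| <= C * `|y - x| * `|t|.
  by apply: prim_bound0; [apply: lbmB; exact: regfield_lbm_time|move=> r _; exact: HC].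
apply: (le_trans H); move: yx; rewrite ltr_pdivlMr ?mulr_gt0 ?ltr_wpDl// => /ltW yx.
apply: le_trans yx; rewrite mulrC mulrA [leRHS]mulrC [leRHS]mulrAC -!mulrA [C * _]mulrC.
by rewrite mulrA [leRHS]mulrC ler_wpM2r ?(ltW C0)// mulrC ler_wpM2l// lerDl.
Qed.


(** The modulus of continuity of [k] in time does not depend on [x], so the difference quotients of
    the inner primitive converge uniformly in [x]. *)
Lemma is_derive_prim_param k f (b s : R) : regfield k -> lbm f ->
  is_derive s 1 (fun t => prim (fun x => f x * prim (fun r => k r x) t) b)
    (prim (fun x => f x * k s x) b).
Proof.
move=> nk lf; have [_ _ T] := nk; have [_ /(_ `|b|)[M HM]] := lf.
have M0 : 0 <= M by rewrite (le_trans _ (HM 0 _)) ?normr0.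
have lp t : lbm (fun x => prim (fun r => k r x) t).
  by apply: continuous_lbm; exact: regfield_prim_time_cont.
apply/is_derive_epsP => e e0.
have b0 : 0 < (M + 1) * (`|b| + 1) by rewrite mulr_gt0 ?ltr_wpDl.
have [|d d0 K] := T s (e / ((M + 1) * (`|b| + 1))); first by rewrite divr_gt0.
exists d => // t ts.
have lk u : lbm (fun x => f x * k u x) by apply: lbmM => //; exact: regfield_lbm.
have lfp u : lbm (fun x => f x * prim (fun r => k r x) u) by exact: lbmM.
rewrite mulrC -(primZ _ _ (lk s)) -!primBf//; last first.
- exact: lbmZ.
- exact: lbmB.
have H : `|prim ((fun x => f x * prim (fun r => k r x) t) \- (fun x => f x * prim (fun r => k r x) s)
   \- (fun x => (t - s) * (f x * k s x))) b| <=
    (M * (e / ((M + 1) * (`|b| + 1)) * `|t - s|)) * `|b|.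
  apply: prim_bound0; first by apply: lbmB; [exact: lbmB|exact: lbmZ].
  move=> x xb /=.
  rewrite (_ : _ - _ = f x * (prim (fun r => k r x) t - prim (fun r => k r x) s - k s x * (t - s))); last by ring.
  rewrite normrM ler_pM//; first exact: HM.
  have := @prim_cst R (k s x) => pc.
  rewrite (_ : _ - _ = prim ((fun r => k r x) \- (fun=> k s x)) t - prim ((fun r => k r x) \- (fun=> k s x)) s); last first.
    by rewrite !primBf ?pc//; [ring|exact: regfield_lbm_time|exact: lbm_cst|exact: regfield_lbm_time|exact: lbm_cst].
  apply: prim_bound; first by apply: lbmB; [exact: regfield_lbm_time|exact: lbm_cst].
  move=> r /andP[r1 r2]; apply: K; apply: le_lt_trans ts; exact: between_dist.
apply: (le_trans H).
rewrite [leRHS]mulrC (_ : M * _ * _ = `|t - s| * (e * ((M * `|b|) / ((M + 1) * (`|b| + 1))))); last by ring.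
rewrite ler_wpM2l// ler_piMr ?(ltW e0)// ler_pdivrMr// mul1r.
by rewrite ler_pM// lerDl.
Qed.

(** Exchange of the two integrals by one-dimensional calculus: both sides have the same derivative
    in [t] and agree at t = s. *)
Lemma prim_swap k f (b s t : R) : regfield k -> lbm f ->
  prim (fun x => f x * (prim (fun r => k r x) t - prim (fun r => k r x) s)) b =
  prim (fun r => prim (fun x => f x * k r x) b) t - prim (fun r => prim (fun x => f x * k r x) b) s.
Proof.
move=> nk lf.
have lh u : lbm (fun x => f x * prim (fun r => k r x) u).
  by apply: lbmM => //; apply: continuous_lbm; exact: regfield_prim_time_cont.
have cq : continuous (fun r => prim (fun x => f x * k r x) b).
  have := @regfield_cont_int k f b nk lf.
  rewrite (_ : (fun _ => _) = (fun r => prim (fun x => f x * k r x) b))//.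
  by apply/funext => r; apply: eq_prim => x; rewrite mulrC.
have -> := @prim_FTC R (fun t => prim (fun x => f x * prim (fun r => k r x) t) b)
  _ (fun u => is_derive_prim_param b u nk lf) cq s t.
by rewrite -(primBf _ (lh t) (lh s)); apply: eq_prim => x /=; ring.
Qed.

End Nice.

(** * Regularity of the stream function *)

Section KopNice.
Context {R : realType}.
Variable L : R.
Hypothesis L0 : 0 < L.
Hypothesis Lpi : L <= pi / 2.
Implicit Types (k : R -> R -> R) (f : R -> R) (x y M : R).

Let sinL : 0 < sin L.
Proof. by apply: sin_gt0_pi; rewrite L0/= (le_lt_trans Lpi)//; have := pi_gt0 R; lra. Qed.

Lemma Kop1_periodic f : continuous f -> has_period L f -> has_period L (Kop1 L f).
Proof.
move=> cf pf x.
have d y : is_derive y 1 (Kop L f) (Kop1 L f y) by exact: is_derive_Kop.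
have E y : derive1 (Kop L f) y = Kop1 L f y.
  by rewrite derive1E (@derive_val _ _ _ _ _ _ _ (d y)).
rewrite -!E; apply: derive1_periodic; last exact: Kop_periodic.
by move=> y; have [] := d y.
Qed.

Definition KopC : R := (sin L)^-1 * (2 * L).

Lemma KopC_gt0 : 0 < KopC.
Proof. by have l0 := L0; rewrite /KopC mulr_gt0 ?invr_gt0// mulr_gt0. Qed.

Let Kop_bound' f x : lbm f -> 0 <= x <= L ->
  `|Kop L f x| <= (sin L)^-1 * prim (fun y => `|f y|) (2 * L) /\
  `|Kop1 L f x| <= (sin L)^-1 * prim (fun y => `|f y|) (2 * L).
Proof.
move=> lf xL; have [H1 H2] := Kop_bound L0 Lpi lf xL; split => //.
apply: (le_trans H1); rewrite ler_wpM2r//.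
  rewrite -(prim0 (fun y => `|f y|)) prim_homo//; first exact: lbm_norm.
  by have l0 := L0; lra.
by rewrite lef_pV2 ?posrE ?mulr_gt0//; have := sinL; lra.
Qed.

(** Confined to one period, so that it applies to the vorticity: [Kop_periodic] asks for continuity,
    and for rough data the periodicity is carried by the stream function instead. *)
Lemma Kop_sup0 f M x : lbm f -> (forall y, `|f y| <= M) -> 0 <= x <= L ->
  `|Kop L f x| <= KopC * M /\ `|Kop1 L f x| <= KopC * M.
Proof.
move=> lf fM xL; have [H1 H2] := Kop_bound' lf xL.
have l0 := L0.
have P : prim (fun y => `|f y|) (2 * L) <= 2 * L * M.
  have := @prim_boundT R (fun y => `|f y|) M 0 (2 * L) (lbm_norm lf).
  rewrite prim0 !subr0 (ger0_norm (_ : 0 <= 2 * L)); last lra.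
  move=> H; rewrite (mulrC (2 * L) M); apply: le_trans (ler_norm _) _; apply: H => t.
  by rewrite normr_id.
have k : (sin L)^-1 * prim (fun y => `|f y|) (2 * L) <= KopC * M.
  by rewrite /KopC -mulrA ler_wpM2l// invr_ge0 ltW.
by split; [apply: le_trans k|apply: le_trans k].
Qed.

Lemma Kop_sup f M x : continuous f -> has_period L f -> (forall y, `|f y| <= M) ->
  `|Kop L f x| <= KopC * M /\ `|Kop1 L f x| <= KopC * M.
Proof.
move=> cf pf fM; have lf := continuous_lbm cf; split.
- have [y xL <-] := periodic_reduce 0 x L0 (Kop_periodic cf pf).
  by rewrite add0r in xL; have [] := Kop_sup0 lf fM xL.
- have [y xL <-] := periodic_reduce 0 x L0 (Kop1_periodic cf pf).
  by rewrite add0r in xL; have [] := Kop_sup0 lf fM xL.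
Qed.

Lemma regfield_Kop k : regfield k -> (forall t, has_period L (k t)) ->
  regfield (fun t => Kop L (k t)) /\ regfield (fun t => Kop1 L (k t)).
Proof.
move=> nk pk; have [M M0 HM] := regfield_bound nk.
have ck t : continuous (k t) by exact: regfield_cont_space.
have lk t : lbm (k t) by exact: regfield_lbm.
have c0 := KopC_gt0.
have S t x := Kop_sup x (ck t) (pk t) (HM t).
have T : forall s (e : R), 0 < e -> exists2 d : R, 0 < d & forall t, `|t - s| < d ->
    forall x, `|Kop L (k t) x - Kop L (k s) x| <= e /\ `|Kop1 L (k t) x - Kop1 L (k s) x| <= e.
  move=> s e e0; have [_ _ /(_ s (e / KopC))[|d d0 Hd]] := nk; first exact: divr_gt0.
  exists d => // t ts x.
  rewrite -!KopB// -!Kop1B//.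
  have E : KopC * (e / KopC) = e by rewrite [LHS]mulrC divfK ?gt_eqF.
  have := @Kop_sup (k t \- k s) (e / KopC) x; rewrite E; apply.
  - by apply: contB.
  - by move=> y /=; rewrite pk pk.
  - by move=> y; exact: Hd.
split; split.
- by exists (KopC * M) => t x; have [] := S t x.
- exists (KopC * M) => t x y; apply: (@derive_lipschitz _ _ (Kop1 L (k t))).
    by move=> z; exact: is_derive_Kop.
  by move=> z; have [] := S t z.
- move=> s e /(T s)[d d0 Hd]; exists d => // t /Hd H x; by have [] := H x.
- by exists (KopC * M) => t x; have [] := S t x.
- exists (M + 4 * (KopC * M)) => t x y.
  apply: (@derive_lipschitz _ _ (fun z => k t z - 4 * Kop L (k t) z)).
    by move=> z; exact: is_derive_Kop1.
  move=> z; apply: (le_trans (ler_normB _ _)); apply: lerD => //.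
  by rewrite normrM normr_nat ler_wpM2l//; have [] := S t z.
- move=> s e /(T s)[d d0 Hd]; exists d => // t /Hd H x; by have [] := H x.
Qed.

Variables (g G G1 : R -> R -> R) (M : R).
Hypothesis lg : forall t, lbm (g t).
Hypothesis gM : forall t x, `|g t x| <= M.
Hypothesis pG : forall t, has_period L (G t).
Hypothesis dG : forall t x, is_derive x 1 (G t) (G1 t x).
Hypothesis eG : forall t x y, G1 t y - G1 t x =
  prim (fun z => g t z - 4 * G t z) y - prim (fun z => g t z - 4 * G t z) x.
Hypothesis tG : forall s (e : R), 0 < e -> exists2 d : R, 0 < d &
  forall t, `|t - s| < d -> prim (fun x => `|g t x - g s x|) (2 * L) <= e.

Let cG t : continuous (G t).
Proof. by move=> x; exact: is_derive_continuous (dG t x). Qed.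

Let pG1 t : has_period L (G1 t).
Proof.
move=> x; have E y : derive1 (G t) y = G1 t y.
  by rewrite derive1E (@derive_val _ _ _ _ _ _ _ (dG t y)).
rewrite -!E; apply: derive1_periodic; last exact: pG.
by move=> y; have [] := dG t y.
Qed.

Let M0 : 0 <= M. Proof. exact: le_trans (gM 0 0). Qed.

Let lh t : lbm (fun z => g t z - 4 * G t z).
Proof. by apply: lbmB => //; apply: lbmZ; exact: continuous_lbm. Qed.

Let G1_lip t A : (forall x, `|G t x| <= A) -> forall x y, `|G1 t y - G1 t x| <= (M + 4 * A) * `|y - x|.
Proof.
move=> GA x y; rewrite eG prim_boundT// => z.
apply: (le_trans (ler_normB _ _)); apply: lerD => //.
by rewrite normrM normr_nat ler_wpM2l.
Qed.

Let cG1 t : continuous (G1 t).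
Proof.
have [A HA] := periodic_bounded L0 (pG t) (@cG t).
have A0 : 0 <= A by exact: le_trans (HA 0).
have C0 : 0 < M + 4 * A + 1 by have := M0; lra.
move=> x; apply/continuous_at_epsP => e e0; exists (e / (M + 4 * A + 1)); first exact: divr_gt0.
move=> y; rewrite ltr_pdivlMr// => yx; apply: (le_trans (G1_lip HA x y)).
by apply: le_trans (ltW yx); rewrite mulrC ler_wpM2l// lerDl.
Qed.

Let KG t x : Kop L (g t) x = G t x /\ Kop1 L (g t) x = G1 t x.
Proof. exact: (@Kop_green _ L L0 Lpi (g t) (G t) (G1 t) M). Qed.

(** [Kop] is bounded from L^1 to sup norm together with its derivative. Hence L^1 continuity of [g]
    in time becomes continuity of [G] and [G1] in time, uniformly in space. The Lipschitz bound on
    [G1] comes from the boundedness of g - 4 G. *)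
Lemma stream_nice : regfield G /\ regfield G1.
Proof.
have c0 := KopC_gt0.
have S t x : `|G t x| <= KopC * M /\ `|G1 t x| <= KopC * M.
  split.
  - have [y xL <-] := periodic_reduce 0 x L0 (pG t).
    rewrite add0r in xL; have [<- _] := KG t y.
    by have [] := Kop_sup0 (lg t) (gM t) xL.
  - have [y xL <-] := periodic_reduce 0 x L0 (@pG1 t).
    rewrite add0r in xL; have [_ <-] := KG t y.
    by have [] := Kop_sup0 (lg t) (gM t) xL.
have T : forall s (e : R), 0 < e -> exists2 d : R, 0 < d & forall t, `|t - s| < d ->
    forall x, `|G t x - G s x| <= e /\ `|G1 t x - G1 s x| <= e.
  (* The factor sin L compensates the norm 1 / sin L of [Kop] from L^1. *)
  move=> s e e0; have [|d d0 Hd] := tG s (e := e * sin L); first exact: mulr_gt0.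
  exists d => // t ts x.
  have H y : 0 <= y <= L -> `|G t y - G s y| <= e /\ `|G1 t y - G1 s y| <= e.
    move=> yL; have [<- <-] := KG t y; have [<- <-] := KG s y.
    rewrite -!KopB// -!Kop1B//.
    have lgts : lbm (g t \- g s) by exact: lbmB.
    have [H1 H2] := Kop_bound' lgts yL.
    have P : (sin L)^-1 * prim (fun z => `|(g t \- g s) z|) (2 * L) <= e.
      by rewrite mulrC ler_pdivrMr//; exact: Hd.
    by split; apply: le_trans P.
  split.
  - have pB : has_period L (fun z => G t z - G s z) by move=> z; rewrite !pG.
    by have [y xL <-] := periodic_reduce 0 x L0 pB; rewrite add0r in xL; have [] := H y xL.
  - have pB : has_period L (fun z => G1 t z - G1 s z) by move=> z; rewrite !pG1.
    by have [y xL <-] := periodic_reduce 0 x L0 pB; rewrite add0r in xL; have [] := H y xL.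
split; split.
- by exists (KopC * M) => t x; have [] := S t x.
- exists (KopC * M) => t; apply: (@derive_lipschitz _ _ (G1 t)) => // z.
  by have [] := S t z.
- move=> s e /(T s)[d d0 Hd]; exists d => // t /Hd H x; by have [] := H x.
- by exists (KopC * M) => t x; have [] := S t x.
- exists (M + 4 * (KopC * M)) => t x y; apply: G1_lip => z; by have [] := S t z.
- move=> s e /(T s)[d d0 Hd]; exists d => // t /Hd H x; by have [] := H x.
Qed.

End KopNice.

(** * The weak formulation *)

Section Weak.
Context {R : realType}.
Notation mu := (@lebesgue_measure R).

Lemma abs_cont_int0 (u a : R -> R) (P : R) : abs_cont u a -> u P = u 0 -> prim a P = 0.
Proof. by move=> [_ _ _ H] uP; have := H 0 P; rewrite uP subrr prim0 subr0. Qed.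

(** Here f = (4 + d_xx) psi. The two integrals of the weak equation are rewritten without [g], so
    that they become continuous in time; each identity says that an exact derivative has zero
    integral over a period. *)
Lemma space_identities (g G G1 psi psi1 f : R -> R) (P : R) :
  lbm g -> abs_cont G G1 -> abs_cont G1 (fun x => g x - 4 * G x) ->
  abs_cont psi psi1 -> abs_cont psi1 (fun x => f x - 4 * psi x) -> lbm f ->
  G P = G 0 -> G1 P = G1 0 -> psi P = psi 0 -> psi1 P = psi1 0 ->
  prim (fun x => g x * psi x) P = prim (fun x => G x * f x) P /\
  prim (fun x => 2 * (g x * (G x * psi1 x + G1 x * psi x))) P =
  prim (fun x => - 2 * (G x * G1 x) * f x - 3 * (G1 x * G1 x) * psi1 x) P.
Proof.
move=> lg aG aG1 aP aP1 lf eG eG1 eP eP1.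
have lG : lbm G by case: aG => /continuous_lbm.
have lG1 : lbm G1 by case: aG1 => /continuous_lbm.
have lP : lbm psi by case: aP => /continuous_lbm.
have lP1 : lbm psi1 by case: aP1 => /continuous_lbm.
split.
(* The derivative of G' psi - G psi' is g psi - G f. *)
- have Q := abs_contD (abs_contM aG1 aP) (abs_contZ (-1) (abs_contM aG aP1)).
  have := @abs_cont_int0 _ _ P Q; rewrite /= eG eG1 eP eP1 => /(_ erefl) Q0.
  apply/eqP; rewrite -subr_eq0 -primBf; [|exact: lbmM..].
  by rewrite -Q0; apply/eqP/eq_prim => x /=; ring.
(* The derivative of G' (2 G psi' + G' psi) + 8 G^2 psi is 2 g (G psi' + G' psi) + 2 G G' f + 3 G'^2
   psi'. *)
- have Q := abs_contD (abs_contM aG1 (abs_contD (abs_contZ 2 (abs_contM aG aP1)) (abs_contM aG1 aP)))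
    (abs_contZ 8 (abs_contM (abs_contM aG aG) aP)).
  have := @abs_cont_int0 _ _ P Q; rewrite /= eG eG1 eP eP1 => /(_ erefl) Q0.
  apply/eqP; rewrite -subr_eq0 -primBf.
  + by rewrite -Q0; apply/eqP/eq_prim => x /=; ring.
  + by apply: lbmZ; apply: lbmM => //; apply: lbmD; exact: lbmM.
  + by apply: lbmB; apply: lbmM => //; apply: lbmZ; exact: lbmM.
Qed.

(* Test with [eta' = rho (w - c)], [w = U - int Phi], [c] the [rho]-mean of [w]:
   this gives [int rho (w - c)^2 = 0]. *)
Lemma weak_derivative (U Phi : R -> R) : continuous U -> continuous Phi ->
  (forall eta eta1 : R -> R, (forall t : R, is_derive t 1 eta (eta1 t)) -> continuous eta1 ->
     (exists K : R, forall t, K < `|t| -> eta t = 0 /\ eta1 t = 0) ->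
     \int[mu]_t (eta1 t * U t + eta t * Phi t) = 0) ->
  forall a b : R, a <= b -> U b - U a = prim Phi b - prim Phi a.
Proof.
move=> cU cP H a b ab.
pose a' := a - 1; pose b' := b + 1.
have ab' : a' < b' by rewrite /a' /b'; lra.
(* A weight that is positive exactly on ]a', b'[, an interval with margin 1 so that [a] and [b] are
   interior. Continuity is enough, since the test function is a primitive. *)
pose rho (t : R) := Num.max 0 ((t - a') * (b' - t)).
have lP := continuous_lbm cP.
have cid : continuous (fun t : R => t) by move=> t; exact: cvg_id.
have cst (c : R) : continuous (fun _ : R => c) by move=> t; exact: cst_continuous.
have cpP : continuous (prim Phi) by move=> t; exact: is_derive_continuous (is_derive_prim lP (cP t)).
have crho : continuous rho.
  move=> t; apply: (@continuous_max _ _ (fun=> 0) (fun t => (t - a') * (b' - t)) t).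
    exact: cst_continuous.
  by apply: contM; apply: contB.
have rho0 (t : R) : 0 <= rho t by rewrite le_max lexx.
have rho_out (t : R) : t <= a' \/ b' <= t -> rho t = 0.
  move=> tab; apply/max_idPl; case: tab => ?.
    by rewrite mulr_le0_ge0; lra.
  by rewrite mulr_ge0_le0; lra.
have rho_in (t : R) : a' < t < b' -> 0 < rho t.
  move=> /andP[? ?]; rewrite lt_max; apply/orP; right; rewrite mulr_gt0; lra.
pose w (t : R) := U t - prim Phi t.
have cw : continuous w by exact: contB.
have lrho := continuous_lbm crho; have lw := continuous_lbm cw.
have lrw := lbmM lrho lw.
pose I f := prim f b' - prim f a' : R.
have Irho : 0 < I rho.
  rewrite lt_neqAle prim_ge0 ?(ltW ab')// andbT; apply/eqP => I0.
  have := @cont_zero _ rho a' b' crho (fun t _ => rho0 t).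
  move=> /(_ _ ((a' + b') / 2)) K.
  have : rho ((a' + b') / 2) = 0 by apply: K; [move: I0; rewrite /I; lra|apply/andP; split; lra].
  by move/eqP; rewrite gt_eqF// rho_in//; apply/andP; split; lra.
(* This choice gives [eta1] zero mean, so its primitive [eta] vanishes beyond [b'] as well as before
   [a']. *)
pose c := I (rho \* w) / I rho.
pose eta1 (t : R) := rho t * (w t - c).
have ceta1 : continuous eta1 by apply: contM => //; apply: contB.
have leta1 := continuous_lbm ceta1.
pose eta (t : R) := prim eta1 t - prim eta1 a'.
have deta (t : R) : is_derive t 1 eta (eta1 t).
  apply: derB (is_derive_prim leta1 (ceta1 t)) (is_derive_cst _ _ _) _; by rewrite subr0.
have ceta : continuous eta by move=> t; exact: is_derive_continuous (deta t).
have eta1_out (t : R) : t <= a' \/ b' <= t -> eta1 t = 0 by move=> /rho_out; rewrite /eta1 => ->; rewrite mul0r.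
have int_c (d : R) : I (fun t => rho t * (w t - d)) = I (rho \* w) - d * I rho.
  rewrite /I (_ : (fun t => _) = (rho \* w) \- (fun t => d * rho t)).
    by rewrite !primBf ?primZ//; [ring|exact: lbmZ..].
  by apply/funext => t /=; ring.
have int_eta1 : I eta1 = 0.
  by rewrite /eta1 int_c /c divfK ?subrr ?gt_eqF.
have eta_out (t : R) : t <= a' \/ b' <= t -> eta t = 0.
  have Z (x y : R) : (forall t, Num.min x y <= t <= Num.max x y -> eta1 t = 0) -> prim eta1 y - prim eta1 x = 0.
    move=> xy; apply/eqP; rewrite -normr_le0 -(mul0r `|y - x|).
    by apply: prim_bound => // s /xy ->; rewrite normr0.
  case=> ta.
  - apply: Z => s; rewrite (max_idPl ta) => /andP[_ sa]; by apply: eta1_out; left.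
  - have z1 : prim eta1 t - prim eta1 b' = 0.
      by apply: Z => s; rewrite (min_idPl ta) => /andP[sb _]; apply: eta1_out; right.
    have z2 : prim eta1 b' - prim eta1 a' = 0 := int_eta1.
    by rewrite /eta; lra.
pose J (t : R) := eta1 t * U t + eta t * Phi t.
have cJ : continuous J by apply: contD; apply: contM.
have lJ := continuous_lbm cJ.
have J0 : I J = 0.
  rewrite /I -primB ?(ltW ab')// Rintegral_mkcond.
  rewrite (_ : J \_ `[a', b'] = J).
    apply: (H eta eta1) => //; exists (`|a'| + `|b'|) => t tK.
    have out : t <= a' \/ b' <= t.
      have [?|ta] := leP t a'; [by left|right; rewrite leNgt; apply/negP => tb].
      move: tK; apply/negP; rewrite -leNgt ler_norml; apply/andP; split.
        by have := ler_norm (- a'); rewrite normrN; have := normr_ge0 b'; lra.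
      by have := ler_norm b'; have := normr_ge0 a'; lra.
    by rewrite eta_out// eta1_out.
  apply/funext => t; rewrite patchE; case: ifPn => //.
  rewrite notin_setE /= in_itv/= => /negP; rewrite negb_and -!ltNge => /orP tab.
  have out : t <= a' \/ b' <= t by case: tab => /ltW ?; [left|right].
  by rewrite /J eta_out// eta1_out// !mul0r addr0.
pose S (t : R) := eta1 t * prim Phi t + eta t * Phi t.
have cS : continuous S by apply: contD; apply: contM.
have lS := continuous_lbm cS.
have S0 : I S = 0.
  have dS (t : R) : is_derive t 1 (fun t => eta t * prim Phi t) (S t).
    exact: derM (deta t) (is_derive_prim lP (cP t)) erefl.
  rewrite /I (prim_FTC dS cS) (eta_out a'); last by left.
  by rewrite (eta_out b') ?mul0r ?subrr//; right.
pose sq (t : R) := rho t * ((w t - c) * (w t - c)).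
have csq : continuous sq by apply: contM => //; apply: contM; apply: contB.
have sq0 : I sq = 0.
  have -> : I sq = I J - I S - c * I eta1.
    have -> : sq = (J \- S) \- (fun t => c * eta1 t).
      by apply/funext => t; rewrite /= /sq /J /S /eta1 /w; ring.
    rewrite /I !(primBf _ (lbmB lJ lS) (lbmZ c leta1)) !(primBf _ lJ lS) !(primZ _ _ leta1).
    by ring.
  by rewrite J0 S0 int_eta1; ring.
have wc (t : R) : a' < t < b' -> w t = c.
  move=> tab.
  have Q : sq t = 0.
    apply: (@cont_zero _ sq a' b' csq) => //; last by move: sq0; rewrite /I; lra.
    by move=> x _; rewrite mulr_ge0// -expr2 sqr_ge0.
  move/eqP: Q; rewrite mulf_eq0 gt_eqF ?rho_in//= -expr2 sqrf_eq0 subr_eq0.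
  by move/eqP.
have wa : w a = c by apply: wc; rewrite /a' /b'; apply/andP; split; lra.
have wb : w b = c by apply: wc; rewrite /a' /b'; apply/andP; split; lra.
by move: wa wb; rewrite /w; lra.
Qed.

(** The weak equation is only ever tested against products of a function of time and a function of
    space. *)
Lemma test_function_tensor (eta eta1 psi psi1 : R -> R) :
  (forall t : R, is_derive t 1 eta (eta1 t)) -> continuous eta1 ->
  (exists K : R, forall t, K < `|t| -> eta t = 0) ->
  (forall x : R, is_derive x 1 psi (psi1 x)) -> continuous psi1 ->
  (forall x, psi (x + 2 * pi) = psi x) ->
  let phi := fun t x => eta t * psi x in
  test_function phi /\ (forall t x, dt phi t x = eta1 t * psi x) /\
  (forall t x, dth phi t x = eta t * psi1 x).
Proof.
move=> de c1 [K HK] dp cp1 pp phi.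
have Dt (t x : R) : is_derive t 1 (fun s => phi s x) (eta1 t * psi x).
  by apply: derM (de t) (is_derive_cst (psi x) _ _) _; rewrite mulr0 addr0.
have Dx (t x : R) : is_derive x 1 (phi t) (eta t * psi1 x).
  by apply: derZ (dp x) _.
have Et t x : dt phi t x = eta1 t * psi x.
  by rewrite /dt derive1E (@derive_val _ _ _ _ _ _ _ (Dt t x)).
have Ex t x : dth phi t x = eta t * psi1 x.
  by rewrite /dth derive1E (@derive_val _ _ _ _ _ _ _ (Dx t x)).
split=> //.
have ce : continuous eta by move=> t; exact: is_derive_continuous (de t).
have cp : continuous psi by move=> t; exact: is_derive_continuous (dp t).
have joint (u v : R -> R) : continuous u -> continuous v ->
    continuous (fun p : R * R => u p.1 * v p.2).
  move=> cu cv p; apply: continuousM.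
    by apply: (@continuous_comp _ _ _ (fun p : R * R => p.1) u); [exact: cvg_fst|exact: cu].
  by apply: (@continuous_comp _ _ _ (fun p : R * R => p.2) v); [exact: cvg_snd|exact: cv].
split; first by move=> t x; rewrite /phi pp.
split; first by exists K => t x tK; rewrite /phi HK// mul0r.
split; first by move=> t x; split; [have [] := Dt t x|have [] := Dx t x].
split; first exact: joint.
split.
- by rewrite (_ : (fun _ => _) = (fun p : R * R => eta1 p.1 * psi p.2)); [exact: joint|apply/funext => p].
- by rewrite (_ : (fun _ => _) = (fun p : R * R => eta p.1 * psi1 p.2)); [exact: joint|apply/funext => p].
Qed.

End Weak.

(** * Evolution of the stream function *)

Section Evolution.
Context {R : realType}.
Notation mu := (@lebesgue_measure R).
Variable L : R.
Hypothesis L0 : 0 < L.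
Hypothesis Lpi : L <= pi / 2.
Variables (n : nat) (g G : R -> R -> R) (M : R).
Hypothesis nL : 2 * pi = n%:R * L.
Let G1 := dth G.
Hypothesis lg : forall t, lbm (g t).
Hypothesis gM : forall t x, `|g t x| <= M.
Hypothesis pG : forall t, has_period L (G t).
Hypothesis dG : forall t x : R, is_derive x 1 (G t) (G1 t x).
Hypothesis eG : forall t x y, G1 t y - G1 t x =
  prim (fun z => g t z - 4 * G t z) y - prim (fun z => g t z - 4 * G t z) x.
Hypothesis nG : regfield G.
Hypothesis nG1 : regfield G1.
Hypothesis weak : weak_transport g G.
Implicit Types (psi f : R -> R) (t x : R).

Let P : R := 2 * pi.

Let period_2pi f : has_period L f -> has_period P f.
Proof. by move=> pf x; rewrite /P nL has_periodn. Qed.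

Let at_2pi f : has_period L f -> f P = f 0.
Proof. by move=> /period_2pi/(_ 0); rewrite add0r. Qed.

Lemma dth_periodic t : has_period L (G1 t).
Proof. by apply: derive1_periodic (pG t) => x; have [] := dG t x. Qed.

Let aG t : abs_cont (G t) (G1 t).
Proof.
have [A _ HA] := regfield_bound nG; have [B _ HB] := regfield_bound nG1.
apply: abs_cont_C1 => //; [exact: regfield_cont_space|by exists A|by exists B].
Qed.

Let aG1 t : abs_cont (G1 t) (fun x => g t x - 4 * G t x).
Proof.
have [A A0 HA] := regfield_bound nG; have [B B0 HB] := regfield_bound nG1; split.
- exact: regfield_cont_space.
- by apply: lbmB => //; apply: lbmZ; exact: regfield_lbm.
- have M0 : 0 <= M by exact: le_trans (gM 0 0).
  exists (M + 4 * A + B) => x; split.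
    by apply: le_trans (HB t x) _; lra.
  apply: (le_trans (ler_normB _ _)); rewrite normrM normr_nat.
  by have := gM t x; have := HA t x; lra.
- exact: eG.
Qed.

Let Phi (psi1 f : R -> R) t := prim (fun x => - 2 * (G t x * G1 t x) * f x - 3 * (G1 t x * G1 t x) * psi1 x) P.

(** Once [space_identities] has removed [g], both the tested quantity and its flux are continuous in
    time, and [weak_derivative] upgrades the distributional law to one between any two times. *)
Let weak_in_time (psi psi1 f : R -> R) : (forall x : R, is_derive x 1 psi (psi1 x)) ->
  (forall x : R, is_derive x 1 psi1 (f x - 4 * psi x)) -> continuous f ->
  has_period L psi -> has_period L psi1 ->
  forall a b, a <= b -> prim (fun x => G b x * f x) P - prim (fun x => G a x * f x) P =
    prim (Phi psi1 f) b - prim (Phi psi1 f) a.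
Proof.
move=> dp dp1 cf pp pp1.
have cp : continuous psi by move=> x; exact: is_derive_continuous (dp x).
have cp1 : continuous psi1 by move=> x; exact: is_derive_continuous (dp1 x).
have lf := continuous_lbm cf.
have lp1 := continuous_lbm cp1; have lp := continuous_lbm cp.
have bp := periodic_bounded L0 pp cp; have bp1 := periodic_bounded L0 pp1 cp1.
have ap : abs_cont psi psi1 by exact: abs_cont_C1.
have pf : has_period L (fun x => f x - 4 * psi x).
  have E y : derive1 psi1 y = f y - 4 * psi y.
    by rewrite derive1E (@derive_val _ _ _ _ _ _ _ (dp1 y)).
  move=> x; rewrite -!E; apply: derive1_periodic pp1 _ => y; by have [] := dp1 y.
have cf4 : continuous (fun x => f x - 4 * psi x) by apply: contB => //; exact: contZ.
have ap1 : abs_cont psi1 (fun x => f x - 4 * psi x).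
  by apply: abs_cont_C1 => //; exact: periodic_bounded pf cf4.
have ID t := space_identities (lg t) (aG t) (aG1 t) ap ap1 lf (at_2pi (pG t))
  (at_2pi (@dth_periodic t)) (at_2pi pp) (at_2pi pp1).
have nGG1 : regfield (fun t x => - 2 * (G t x * G1 t x)) by apply: regfieldZ; exact: regfieldM.
have nG1G1 : regfield (fun t x => 3 * (G1 t x * G1 t x)) by apply: regfieldZ; exact: regfieldM.
have cU : continuous (fun t => prim (fun x => G t x * f x) P) by exact: regfield_cont_int.
have cPhi : continuous (Phi psi1 f).
  have -> : Phi psi1 f = fun t => prim (fun x => - 2 * (G t x * G1 t x) * f x) P
       - prim (fun x => 3 * (G1 t x * G1 t x) * psi1 x) P.
    apply/funext => t; rewrite -primBf//.
      exact: (lbmM (regfield_lbm t nGG1) lf).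
    exact: (lbmM (regfield_lbm t nG1G1) lp1).
  by apply: contB; [exact: regfield_cont_int nGG1 lf|exact: regfield_cont_int nG1G1 lp1].
move=> a b ab; apply: (weak_derivative cU cPhi) => // eta eta1 de ce [K HK].
have K0 : exists K : R, forall t, K < `|t| -> eta t = 0 by exists K => t /HK[].
have [tf [Et Ex]] := test_function_tensor de ce K0 dp cp1 (period_2pi pp).
have := weak tf; apply: etrans; apply: eq_Rintegral => t _.
have lgp : lbm (fun x => g t x * psi x) by exact: lbmM.
have lq : lbm (fun x => 2 * (g t x * (G t x * psi1 x + G1 t x * psi x))).
  apply: lbmZ; apply: lbmM => //; apply: lbmD; apply: lbmM => //; exact: regfield_lbm.
rewrite -(ID t).1 /Phi -(ID t).2 -(primZ _ _ lgp) -(primZ _ _ lq) -primD; last first.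
- exact: lbmZ.
- exact: lbmZ.
rewrite (_ : (fun x => g t x * _) = (fun x => eta1 t * (g t x * psi x)) \+
    (fun x => eta t * (2 * (g t x * (G t x * psi1 x + G1 t x * psi x))))).
  rewrite primB ?prim0 ?subr0//; last by rewrite mulr_ge0// pi_ge0.
  by apply: lbmD; exact: lbmZ.
by apply/funext => x; rewrite /= Et Ex /G1; ring.
Qed.

(** The test function is psi = 1, for which f = 4 and psi' = 0. The flux is then the integral of - 8
    G G', the derivative of - 4 G^2. *)
Lemma mean_conserved a b : prim (g b) P = prim (g a) P.
Proof.
suff H (c d : R) : c <= d -> prim (g d) P = prim (g c) P.
  by have [/H//|/ltW/H] := leP a b.
move=> cd.
have c1 : continuous (fun _ : R => 1 : R) by move=> x; exact: cst_continuous.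
have c0 : continuous (fun _ : R => 0 : R) by move=> x; exact: cst_continuous.
have c4 : continuous (fun _ : R => 4 : R) by move=> x; exact: cst_continuous.
have p1 : has_period L (fun _ : R => 1 : R) by [].
have p0 : has_period L (fun _ : R => 0 : R) by [].
have d1 (x : R) : is_derive x 1 (fun _ : R => 1 : R) (0 : R) by exact: is_derive_cst.
have d0 (x : R) : is_derive x 1 (fun _ : R => 0 : R) (4 - 4 * 1 : R).
  by rewrite mulr1 subrr; exact: is_derive_cst.
have ac1 : abs_cont (fun=> 1 : R) (fun=> 0 : R).
  by apply: abs_cont_C1 => //; [exists 1 => x; rewrite normr1|exists 0 => x; rewrite normr0].
have ac0 : abs_cont (fun=> 0 : R) (fun=> 4 - 4 * 1 : R).
  apply: abs_cont_C1 => //.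
  - by move=> x; exact: cst_continuous.
  - by exists 0 => x; rewrite normr0.
  - by exists 0 => x; rewrite mulr1 subrr normr0.
have E t : prim (g t) P = prim (fun x => G t x * 4) P.
  have [<- _] := space_identities (lg t) (aG t) (aG1 t) ac1 ac0 (lbm_cst 4) (at_2pi (pG t))
    (at_2pi (@dth_periodic t)) erefl erefl.
  by apply: eq_prim => x; rewrite mulr1.
rewrite !E; apply/eqP; rewrite -subr_eq0 (weak_in_time d1 d0 c4 p1 p0 cd); apply/eqP.
have Z t : Phi (fun=> 0) (fun=> 4) t = 0.
  have Q := abs_contZ (-4) (abs_contM (aG t) (aG t)).
  have := abs_cont_int0 (P := P) Q; rewrite /= at_2pi// => /(_ erefl) Q0.
  by rewrite -[RHS]Q0; apply: eq_prim => x /=; ring.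
have -> : Phi (fun=> 0) (fun=> 4) = (fun=> 0) by apply/funext.
by rewrite !prim_cst !mul0r subrr.
Qed.

Definition Hop t x := Kop L (fun y => G1 t y * G1 t y) x.
Definition Hop1 t x := Kop1 L (fun y => G1 t y * G1 t y) x.

Let nG1sq : regfield (fun t x => G1 t x * G1 t x). Proof. exact: regfieldM. Qed.
Let pG1sq t : has_period L (fun x => G1 t x * G1 t x).
Proof. by move=> x; rewrite !dth_periodic. Qed.
Let cG1sq t : continuous (fun x => G1 t x * G1 t x).
Proof. by apply: contM; exact: regfield_cont_space. Qed.

Lemma regfield_Hop : regfield Hop. Proof. by have [] := regfield_Kop L0 Lpi nG1sq pG1sq. Qed.
Lemma regfield_Hop1 : regfield Hop1. Proof. by have [] := regfield_Kop L0 Lpi nG1sq pG1sq. Qed.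
Lemma Hop_periodic t : has_period L (Hop t).
Proof. exact: Kop_periodic. Qed.
Lemma Hop1_periodic t : has_period L (Hop1 t).
Proof. exact: Kop1_periodic. Qed.
Lemma is_derive_Hop t x : is_derive x 1 (Hop t) (Hop1 t x).
Proof. exact: is_derive_Kop. Qed.
Lemma is_derive_Hop1 t x : is_derive x 1 (Hop1 t) (G1 t x * G1 t x - 4 * Hop t x).
Proof. exact: is_derive_Kop1. Qed.

(** The time derivative of [G]: apply (4 + d_thth)^-1 to d_t g = - 2 G g' = - (4 + d_thth)(2 G G') +
    3 (G'^2)'. *)
Definition Nop t x := 3 * Hop1 t x - 2 * (G t x * G1 t x).

Lemma regfield_Nop : regfield Nop.
Proof. by apply: regfieldB; apply: regfieldZ; [exact: regfield_Hop1|exact: regfieldM]. Qed.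

(* The difference [Z] of the two sides is tested against [psi = Kop Z]. *)
Lemma evolution a b x : a <= b ->
  G b x - G a x = prim (fun r => Nop r x) b - prim (fun r => Nop r x) a.
Proof.
move=> ab; have nN := regfield_Nop.
pose Z (x : R) := G b x - G a x - (prim (fun r => Nop r x) b - prim (fun r => Nop r x) a).
suff : Z x = 0 by rewrite /Z; lra.
have pZ : has_period L Z.
  move=> y; rewrite /Z !pG.
  have -> // : (fun r => Nop r (y + L)) = (fun r => Nop r y).
  by apply/funext => r; rewrite /Nop Hop1_periodic pG dth_periodic.
have cZ : continuous Z.
  by apply: contB; apply: contB; try exact: regfield_cont_space; exact: regfield_prim_time_cont.
have lZ := continuous_lbm cZ.
pose psi := Kop L Z; pose psi1 := Kop1 L Z.
have dp (y : R) : is_derive y 1 psi (psi1 y) by exact: is_derive_Kop.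
have dp1 (y : R) : is_derive y 1 psi1 (Z y - 4 * psi y) by exact: is_derive_Kop1.
have pp : has_period L psi by exact: Kop_periodic.
have pp1 : has_period L psi1 by exact: Kop1_periodic.
have cp : continuous psi by move=> y; exact: is_derive_continuous (dp y).
have cp1 : continuous psi1 by move=> y; exact: is_derive_continuous (dp1 y).
have PhiE t : Phi psi1 Z t = prim (fun y => Z y * Nop t y) P.
  have aP : abs_cont psi psi1 by apply: abs_cont_C1 => //; [exact: (periodic_bounded L0 pp cp)|exact: (periodic_bounded L0 pp1 cp1)].
  have aP1 : abs_cont psi1 (fun y => Z y - 4 * psi y).
    apply: abs_cont_C1 => //; [by apply: contB => //; exact: contZ|exact: (periodic_bounded L0 pp1 cp1)|].
    apply: (periodic_bounded L0); last by apply: contB => //; exact: contZ.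
    by move=> y; rewrite pZ pp.
  have aH : abs_cont (Hop t) (Hop1 t).
    have [A _ HA] := regfield_bound regfield_Hop; have [B _ HB] := regfield_bound regfield_Hop1.
    apply: abs_cont_C1; [exact: is_derive_Hop|exact: regfield_cont_space regfield_Hop1|by exists A|by exists B].
  have aH1 : abs_cont (Hop1 t) (fun y => G1 t y * G1 t y - 4 * Hop t y).
    have nn : regfield (fun t y => G1 t y * G1 t y - 4 * Hop t y).
      by apply: regfieldB => //; apply: regfieldZ; exact: regfield_Hop.
    have [A _ HA] := regfield_bound nn; have [B _ HB] := regfield_bound regfield_Hop1.
    apply: abs_cont_C1; [exact: is_derive_Hop1|apply: contB; [exact: cG1sq|apply: contZ; exact: regfield_cont_space regfield_Hop]|by exists B|by exists A].
  (* The derivative of H' psi' + 4 H psi is G'^2 psi' + H' Z. Its zero integral turns the term - 3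
     G'^2 psi' of [Phi] into 3 H' Z. *)
  have Q := abs_contD (abs_contM aH1 aP1) (abs_contZ 4 (abs_contM aH aP)).
  have := abs_cont_int0 (P := P) Q; rewrite /= (at_2pi (@Hop1_periodic t)) (at_2pi pp1)
    (at_2pi (@Hop_periodic t)) (at_2pi pp) => /(_ erefl) Q0.
  have lk (k : R -> R -> R) (f : R -> R) : regfield k -> continuous f -> lbm (fun y => k t y * f y).
    by move=> nk cf; apply: lbmM; [exact: regfield_lbm|exact: continuous_lbm].
  have l1 : lbm (fun y => - 2 * (G t y * G1 t y) * Z y - 3 * (G1 t y * G1 t y) * psi1 y).
    apply: lbmB.
      by apply: (lk (fun t y => - 2 * (G t y * G1 t y))) => //; apply: regfieldZ; exact: regfieldM.
    by apply: (lk (fun t y => 3 * (G1 t y * G1 t y))) => //; exact: regfieldZ.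
  have l2 : lbm (fun y => Z y * Nop t y) by apply: lbmM => //; exact: regfield_lbm.
  apply/eqP; rewrite -subr_eq0 /Phi -primBf// -[X in _ == X](mulr0 (-3)) -Q0.
  have lQ : lbm (fun y => (G1 t y * G1 t y - 4 * Hop t y) * psi1 y + Hop1 t y * (Z y - 4 * psi y) +
      4 * (Hop1 t y * psi y + Hop t y * psi1 y)) by case: Q.
  by rewrite -primZ//; apply/eqP/eq_prim => y /=; rewrite /Nop; ring.
have W := weak_in_time dp dp1 cZ pp pp1 ab.
have Phi_ext : Phi psi1 Z = (fun t => prim (fun y => Z y * Nop t y) P) by apply/funext.
rewrite Phi_ext -(prim_swap _ _ _ nN lZ) in W.
have lGb t : lbm (fun y => G t y * Z y) by apply: lbmM => //; exact: regfield_lbm.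
have lzp : lbm (fun y => Z y * (prim (fun r => Nop r y) b - prim (fun r => Nop r y) a)).
  apply: lbmM => //; apply: continuous_lbm; apply: contB; exact: regfield_prim_time_cont.
have Z2 : prim (fun y => Z y * Z y) P = prim (fun y => Z y * Z y) 0.
  rewrite prim0 -(subrr (prim (fun y => G b y * Z y) P - prim (fun y => G a y * Z y) P)).
  rewrite [X in _ = _ - X]W -primBf// -primBf//; last exact: lbmB.
  by apply: eq_prim => y; rewrite /Z /=; ring.
(* [cont_zero] speaks of interior points only; a representative in [pi / 4, pi / 4 + L] is interior
   to [0, 2 pi] because L <= pi / 2. *)
have [y /andP[y1 y2] <-] := periodic_reduce (pi / 4) x L0 pZ.
have l0 := L0; have lpi := Lpi; have p0 := pi_gt0 R.
have : Z y * Z y = 0.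
  apply: (@cont_zero _ (fun y => Z y * Z y) 0 P) => //.
  - exact: contM.
  - by move=> z _; rewrite -expr2 sqr_ge0.
  - by rewrite /P; apply/andP; split; lra.
by move/eqP; rewrite -expr2 sqrf_eq0 => /eqP.
Qed.

End Evolution.

(** * The Lagrangian flow *)

Section Growth.
Context {R : realType}.
Implicit Types (f : R -> R) (t x y : R).

Lemma derive_nonincr (F f : R -> R) (a b : R) : a <= b ->
  (forall x : R, a <= x <= b -> is_derive x 1 F (f x)) ->
  (forall x, a <= x <= b -> f x <= 0) -> F b <= F a.
Proof.
move=> ab dF f0; rewrite -lerN2 -(mulN1r (F a)) -(mulN1r (F b)).
apply: (@derive_nondecr R (fun x => -1 * F x) (fun x => -1 * f x)) => // x xab.
  exact: derZ (dF x xab) erefl.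
by rewrite mulN1r oppr_ge0 f0.
Qed.

Lemma derive_bound_at0 (F f : R -> R) (C T : R) : (forall x : R, is_derive x 1 F (f x)) ->
  (forall x, `|x| <= T -> `|f x| <= C) -> forall t, `|t| <= T -> `|F t - F 0| <= C * `|t|.
Proof.
move=> dF fC t tT.
have cF : continuous F by move=> z; exact: is_derive_continuous (dF z).
have [t0|t0] := leP 0 t.
- have [|c] := @MVT_segment R F f 0 t t0 (fun z _ => dF z).
    exact: continuous_subspaceT.
  rewrite in_itv/= => /andP[c0 ct] ->; rewrite subr0 normrM ler_wpM2r// fC//.
  by rewrite ger0_norm// (le_trans ct)// (le_trans (ler_norm t)).
- have [|c] := @MVT_segment R F f t 0 (ltW t0) (fun z _ => dF z).
    exact: continuous_subspaceT.
  rewrite in_itv/= => /andP[c0 ct] E; rewrite distrC E sub0r normrM normrN ler_wpM2r// fC//.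
  rewrite ler0_norm// (le_trans _ tT)// ler0_norm ?(ltW t0)//; lra.
Qed.

(** To avoid differentiating an absolute value, one shows that D^2 exp (- 2 c t) is nonincreasing
    for t >= 0; negative times follow by reflection. *)
Lemma gronwall (D d : R -> R) (c : R) : (forall t : R, is_derive t 1 D (d t)) -> 
  (forall t, `|d t| <= c * `|D t|) -> forall t, `|D t| <= `|D 0| * expR (c * `|t|).
Proof.
have P (E e : R -> R) : (forall t : R, is_derive t 1 E (e t)) ->
    (forall t, `|e t| <= c * `|E t|) -> forall t, 0 <= t -> `|E t| <= `|E 0| * expR (c * t).
  move=> dD dc t t0.
  have de (s : R) : is_derive s 1 (fun s => expR ((- 2 * c) * s)) ((- 2 * c) * expR ((- 2 * c) * s)).
    apply: (der_comp (f := @expR R) (is_derive_expR _) (derZ (is_derive_id _ _) erefl)); ring.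
  have : E t * E t * expR ((- 2 * c) * t) <= E 0 * E 0 * expR ((- 2 * c) * 0).
    apply: (@derive_nonincr (fun s => E s * E s * expR ((- 2 * c) * s))
       (fun s => (2 * (E s * e s) - 2 * c * (E s * E s)) * expR ((- 2 * c) * s))) => // s _.
      by apply: derM (derM (dD s) (dD s) erefl) (de s) _; ring.
    rewrite mulr_le0_ge0 ?expR_ge0// subr_le0 -mulrA ler_wpM2l//.
    rewrite (le_trans (ler_norm _))// normrM -expr2 -real_normK ?num_real// expr2.
    by rewrite mulrCA ler_wpM2l.
  rewrite mulr0 expR0 mulr1 => H.
  rewrite -(@ler_pXn2r _ 2)// ?nnegrE ?mulr_ge0 ?expR_ge0//.
  rewrite exprMn !real_normK ?num_real// -expRM_natl.
  move: H; rewrite -ler_pdivlMr ?expR_gt0// -expRN -!expr2 => /le_trans; apply.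
  by apply: ler_wpM2l; [exact: sqr_ge0|rewrite ler_expR; lra].
move=> dD dc t; have [t0|t0] := leP 0 t; first by rewrite (ger0_norm t0); exact: P dD dc t t0.
have dN (s : R) : is_derive s 1 (fun s => D (-1 * s)) (-1 * d (-1 * s)).
  apply: (der_comp (f := D) (dD _) (derZ (is_derive_id _ _) erefl)); ring.
have dcN s : `|-1 * d (-1 * s)| <= c * `|D (-1 * s)| by rewrite normrM normrN normr1 mul1r.
have nt : 0 <= - t by lra.
by have := P _ _ dN dcN (- t) nt; rewrite mulr0 mulrNN mul1r (ltr0_norm t0).
Qed.

Lemma taylor_bound (f f1 : R -> R) (C : R) : (forall x : R, is_derive x 1 f (f1 x)) ->
  (forall x y, `|f1 y - f1 x| <= C * `|y - x|) ->
  forall x y, `|f y - f x - f1 x * (y - x)| <= C * (y - x) ^+ 2.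
Proof.
move=> df lf x y.
have cf : continuous f by move=> z; exact: is_derive_continuous (df z).
have C0 : 0 <= C by have := lf 0 1; rewrite subr0 normr1 mulr1; apply: le_trans.
have [c cxy E] : exists2 c : R, `|c - x| <= `|y - x| & f y - f x = f1 c * (y - x).
  have [xy|/ltW yx] := leP x y.
  - have [|c] := @MVT_segment R f f1 x y xy (fun z _ => df z); first exact: continuous_subspaceT.
    rewrite in_itv/= => /andP[? ?] E; exists c => //.
    by rewrite !ger0_norm; lra.
  - have [|c] := @MVT_segment R f f1 y x yx (fun z _ => df z); first exact: continuous_subspaceT.
    rewrite in_itv/= => /andP[? ?] E; exists c; last lra.
    by rewrite !ler0_norm; lra.
rewrite E -mulrBl normrM -real_normK ?num_real// expr2 mulrA ler_wpM2r//.
by rewrite (le_trans (lf _ _))// ler_wpM2l.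
Qed.

(** Bookkeeping for [sJ_deriv]: [gs] and [g0] are differences of [G] between two trajectories at
    times s and 0, [a] and [b] the candidate slopes of these differences in [d], and [q] the time
    integral that should equal a - b. *)
Lemma linear_part_bound (gs g0 q a b d B1 B2 B3 : R) : `|gs - d * q - g0| <= B1 ->
  `|gs - a * d| <= B2 -> `|g0 - b * d| <= B3 -> `|(a - (b + q)) * d| <= B1 + B2 + B3.
Proof.
rewrite !ler_norml => /andP[? ?] /andP[? ?] /andP[? ?]; apply/andP; split; lra.
Qed.

Lemma quadratic_zero (a C : R) : (forall d, `|a * d| <= C * d ^+ 2) -> a = 0.
Proof.
move=> H; apply/eqP; rewrite -normr_eq0 eq_le normr_ge0 andbT leNgt; apply/negP => a0.
have C0 : 0 <= C by have := H 1; rewrite mulr1 expr1n mulr1; apply: le_trans.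
have C1 : 0 < 2 * (C + 1) by lra.
have := H (`|a| / (2 * (C + 1))); rewrite normrM normrM normr_id normfV (gtr0_norm C1).
apply/negP; rewrite -ltNge expr2 mulrA [ltRHS]mulrC [X in _ < X]mulrC ltr_pM2r ?divr_gt0//.
rewrite mulrA ltr_pdivrMr// mulrC ltr_pM2l//; lra.
Qed.

End Growth.

(** * The Jacobian of the flow and its first two time derivatives *)

Section Flow.
Context {R : realType}.
Variables (G G1 H H1 N chi : R -> R -> R).
Hypothesis nG : regfield G.
Hypothesis nG1 : regfield G1.
Hypothesis nH : regfield H.
Hypothesis nN : regfield N.
Hypothesis dG : forall t x : R, is_derive x 1 (G t) (G1 t x).
Hypothesis dH1 : forall t x : R, is_derive x 1 (H1 t) (G1 t x * G1 t x - 4 * H t x).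
Hypothesis NE : forall t x, N t x = 3 * H1 t x - 2 * (G t x * G1 t x).
Hypothesis evol : forall a b x, a <= b ->
  G b x - G a x = prim (fun r => N r x) b - prim (fun r => N r x) a.
Hypothesis chi0 : forall th, chi 0 th = th.
Hypothesis dchi : forall t th : R, is_derive t 1 (fun s => chi s th) (2 * G t (chi t th)).
Implicit Types (t s th T : R).

Lemma flow_cont th : continuous (fun t => chi t th).
Proof. by move=> t; exact: is_derive_continuous (dchi t th). Qed.

Lemma flow_unique_gronwall : exists2 c : R, 0 <= c & forall X Y : R -> R,
  (forall t : R, is_derive t 1 X (2 * G t (X t))) ->
  (forall t : R, is_derive t 1 Y (2 * G t (Y t))) ->
  forall t, `|X t - Y t| <= `|X 0 - Y 0| * expR (c * `|t|).
Proof.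
have [C C0 HC] := regfield_lip nG; exists (2 * C); first lra.
move=> X Y dX dY; apply: (@gronwall _ (fun t => X t - Y t) (fun t => 2 * G t (X t) - 2 * G t (Y t))).
by move=> t; rewrite -mulrBr normrM normr_nat -mulrA ler_wpM2l.
Qed.

Definition slope th t := G1 t (chi t th).

Lemma slope_cont th : continuous (slope th).
Proof. exact: regfield_cont_path nG1 (@flow_cont th). Qed.

Let lslope th : lbm (slope th). Proof. exact/continuous_lbm/slope_cont. Qed.

Let dprim th t : is_derive t 1 (prim (slope th)) (slope th t).
Proof. by apply: is_derive_prim; [exact: lslope|exact: slope_cont]. Qed.

(** The solution of the linearised equation J_t = 2 G'(t, chi) J with J = 1 at time 0;
    [is_derive_flow] identifies it with d_th chi. *)
Definition Jac th t := expR (2 * prim (slope th) t).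

Lemma Jac_gt0 th t : 0 < Jac th t. Proof. exact: expR_gt0. Qed.
Lemma Jac0 th : Jac th 0 = 1. Proof. by rewrite /Jac prim0 mulr0 expR0. Qed.

Lemma is_derive_Jac th t : is_derive t 1 (Jac th) (2 * slope th t * Jac th t).
Proof.
apply: (der_comp (f := @expR R) (is_derive_expR _) (derZ (dprim th t) erefl)).
by rewrite /Jac; ring.
Qed.

Let Jac_bound T : exists2 B : R, 0 < B & forall th t, `|t| <= T -> Jac th t <= B /\ (Jac th t)^-1 <= B.
Proof.
have [b b0 Hb] := regfield_bound nG1; exists (expR (2 * (b * T))); first exact: expR_gt0.
move=> th t tT; have P : `|prim (slope th) t| <= b * T.
  apply: (@le_trans _ _ (b * `|t|)); last by rewrite ler_wpM2l ?(ltW b0).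
  by apply: prim_bound0 => // x _; exact: Hb.
move: P; rewrite ler_norml => /andP[P1 P2].
by rewrite /Jac -expRN; split; rewrite ler_expR; lra.
Qed.

(** The difference [D] of two trajectories divided by [J] has time derivative 2 (G(chi') - G(chi) -
    G'(chi) D) / J, which is of second order in th' - th by Taylor and Gronwall. The constant
    depends on [T] only, as the later integration in time requires. *)
Lemma flow_expansion T : exists2 C : R, 0 <= C & forall th th' t, `|t| <= T ->
  `|chi t th' - chi t th - Jac th t * (th' - th)| <= C * (th' - th) ^+ 2 /\
  `|chi t th' - chi t th| <= C * `|th' - th|.
Proof.
have [c c0 Hc] := flow_unique_gronwall.
have [B B0 HB] := Jac_bound T.
have [K K0 HK] := regfield_lip nG1.
pose A := expR (c * T).
have A0 : 0 < A by exact: expR_gt0.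
have GW th th' t : `|t| <= T -> `|chi t th' - chi t th| <= A * `|th' - th|.
  move=> tT; apply: (le_trans (Hc (chi^~ th') (chi^~ th) (dchi^~ th') (dchi^~ th) t)).
  rewrite !chi0 mulrC ler_wpM2r// ler_expR ler_wpM2l//.
pose C1 := B * (2 * K * A ^+ 2 * B * `|T|).
have C10 : 0 <= C1 by rewrite !mulr_ge0 ?exprn_ge0// ltW.
exists (C1 + A); first lra.
move=> th th' t tT; split; last first.
  by apply: le_trans (GW _ _ _ tT) _; rewrite ler_wpM2r// lerDr.
pose D s := chi s th' - chi s th.
have dJ (s : R) : is_derive s 1 (fun s => (Jac th s)^-1) (- 2 * slope th s * (Jac th s)^-1).
  have -> : (fun s => (Jac th s)^-1) = (fun s => expR (- 2 * prim (slope th) s)).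
    by apply/funext => u; rewrite /Jac -expRN mulNr.
  apply: (der_comp (f := @expR R) (is_derive_expR _) (derZ (dprim th s) erefl)).
  by rewrite /Jac -expRN -mulNr; ring.
have dE (s : R) : is_derive s 1 (fun s => D s * (Jac th s)^-1)
    (2 * (G s (chi s th') - G s (chi s th) - slope th s * D s) * (Jac th s)^-1).
  by apply: derM (derB (dchi s th') (dchi s th) erefl) (dJ s) _; rewrite /D; ring.
have E : `|D t * (Jac th t)^-1 - D 0 * (Jac th 0)^-1| <= (2 * K * A ^+ 2 * B * (th' - th) ^+ 2) * `|t|.
  apply: (derive_bound_at0 dE _ tT) => s sT.
  have [_ JB] := HB th s sT.
  rewrite !normrM normr_nat (ger0_norm (_ : 0 <= (Jac th s)^-1)) ?invr_ge0 ?(ltW (Jac_gt0 _ _))//.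
  have T1 := taylor_bound (dG s) (HK s) (chi s th) (chi s th').
  have T2 : `|G s (chi s th') - G s (chi s th) - slope th s * D s| <= K * (A ^+ 2 * (th' - th) ^+ 2).
    apply: (le_trans T1); rewrite ler_wpM2l ?(ltW K0)// -exprMn.
    rewrite -[leLHS]real_normK ?num_real// -[leRHS]real_normK ?num_real//.
    by rewrite lerXn2r ?nnegrE// normrM (gtr0_norm A0); exact: GW.
  rewrite (_ : 2 * K * A ^+ 2 * B * (th' - th) ^+ 2 = 2 * (K * (A ^+ 2 * (th' - th) ^+ 2)) * B); last by ring.
  by apply: ler_pM => //; [rewrite invr_ge0 ltW// Jac_gt0|rewrite ler_wpM2l].
have J0 := Jac_gt0 th t.
rewrite Jac0 invr1 mulr1 /D !chi0 in E.
rewrite (_ : _ - _ = Jac th t * ((chi t th' - chi t th) * (Jac th t)^-1 - (th' - th))); last first.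
  by field; rewrite gt_eqF.
rewrite normrM (gtr0_norm J0).
have [JB _] := HB th t tT.
apply: (@le_trans _ _ (B * ((2 * K * A ^+ 2 * B * (th' - th) ^+ 2) * `|T|))).
  rewrite ler_pM ?(ltW J0)//; apply: (le_trans E); rewrite ler_wpM2l//.
    apply: mulr_ge0 (sqr_ge0 _).
    by rewrite !mulr_ge0 ?exprn_ge0// ltW.
  by rewrite (le_trans tT)// ler_norm.
rewrite [leRHS]mulrDl (_ : C1 * _ = B * (2 * K * A ^+ 2 * B * (th' - th) ^+ 2 * `|T|)); last by rewrite /C1; ring.
by rewrite lerDl; apply: mulr_ge0 (sqr_ge0 _); exact: ltW.
Qed.

Lemma is_derive_flow t th : is_derive th 1 (chi t) (Jac th t).
Proof.
have [C C0 HC] := flow_expansion `|t|.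
apply/is_derive_epsP => e e0; have C1 : 0 < C + 1 by lra.
exists (e / (C + 1)); first exact: divr_gt0.
move=> y; rewrite ltr_pdivlMr// => yx; have [K _] := HC th y t (lexx _).
apply: (le_trans K); rewrite -real_normK ?num_real// expr2 mulrA ler_wpM2r//.
by apply: le_trans (ltW yx); rewrite mulrC ler_wpM2l//; lra.
Qed.

Let composite_expansion (K K1 : R -> R -> R) T : regfield K1 ->
  (forall t x : R, is_derive x 1 (K t) (K1 t x)) ->
  exists2 C : R, 0 <= C & forall th th' t, `|t| <= T ->
    `|K t (chi t th') - K t (chi t th) - K1 t (chi t th) * Jac th t * (th' - th)|
      <= C * (th' - th) ^+ 2.
Proof.
move=> nK1 dK; have [C C0 HC] := flow_expansion T.
have [A A0 HA] := regfield_bound nK1; have [B B0 HB] := regfield_lip nK1.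
exists (B * C ^+ 2 + A * C).
  by rewrite addr_ge0// mulr_ge0 ?exprn_ge0// ltW.
move=> th th' t tT; have [H2 H3] := HC th th' t tT.
rewrite (_ : _ - _ = (K t (chi t th') - K t (chi t th) - K1 t (chi t th) * (chi t th' - chi t th))
  + K1 t (chi t th) * (chi t th' - chi t th - Jac th t * (th' - th))); last by ring.
rewrite mulrDl (le_trans (ler_normD _ _))// lerD//.
  apply: (le_trans (taylor_bound (dK t) (HB t) _ _)).
  rewrite -mulrA ler_wpM2l ?(ltW B0)// -exprMn.
  rewrite -[leLHS]real_normK ?num_real// -[leRHS]real_normK ?num_real//.
  by rewrite lerXn2r ?nnegrE// normrM (ger0_norm C0).
by rewrite normrM -mulrA ler_pM.
Qed.

(** The increment is split into a change of time at the displaced point, controlled by the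
    integrated law for [G], and a change of position at the fixed time [t], controlled by the chain
    rule. The transport term 2 G G' cancels between the two. *)
Lemma is_derive_stream_flow t th :
  is_derive t 1 (fun s => G s (chi s th)) (3 * H1 t (chi t th)).
Proof.
have evol' a b x : G b x - G a x = prim (fun r => N r x) b - prim (fun r => N r x) a.
  by have [/evol//|/ltW/evol E] := leP a b; have := E x; lra.
have dGc := der_comp (f := G t) (dG t (chi t th)) (dchi t th) erefl.
apply/is_derive_epsP => e e0.
have [K K0 HK] := regfield_lip nN; have [_ _ /(_ t (e / 4))[|d1 d10 Hd1]] := nN; first lra.
have /is_derive_epsP/(_ (e / 2))[|d2 d20 Hd2] := dGc; first lra.
have /continuous_at_epsP/(_ (e / 4 / K))[|d3 d30 Hd3] := @flow_cont th t.
  by rewrite !divr_gt0.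
exists (Num.min d1 (Num.min d2 d3)); first by rewrite !lt_min d10 d20.
move=> s; rewrite !lt_min => /and3P[s1 s2 s3].
have {}Hd2 := Hd2 s s2; have {}Hd3 := Hd3 s s3.
have A : `|G s (chi s th) - G t (chi s th) - N t (chi t th) * (s - t)| <= e / 2 * `|s - t|.
  rewrite evol'; have ln x := regfield_lbm_time x nN.
  rewrite (_ : _ - _ = prim ((fun r => N r (chi s th)) \- (fun=> N t (chi t th))) s -
     prim ((fun r => N r (chi s th)) \- (fun=> N t (chi t th))) t); last first.
    by rewrite !(primBf _ (ln _) (lbm_cst _)) !prim_cst; ring.
  apply: prim_bound; first by apply: lbmB => //; exact: lbm_cst.
  move=> r /andP[r1 r2] /=.
  rewrite (_ : _ - _ = (N r (chi s th) - N t (chi s th)) + (N t (chi s th) - N t (chi t th))); last by ring.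
  rewrite (le_trans (ler_normD _ _))// (_ : e / 2 = e / 4 + e / 4); last by field.
  apply: lerD; first by apply: Hd1; apply: le_lt_trans s1; exact: between_dist.
  apply: (le_trans (HK _ _ _)); by move: Hd3; rewrite ler_pdivlMr// mulrC.
rewrite (_ : _ - _ = (G s (chi s th) - G t (chi s th) - N t (chi t th) * (s - t)) +
  (G t (chi s th) - G t (chi t th) - G1 t (chi t th) * (2 * G t (chi t th)) * (s - t))); last first.
  by rewrite NE; ring.
apply: (le_trans (ler_normD _ _)); rewrite [leRHS](_ : _ = e / 2 * `|s - t| + e / 2 * `|s - t|); last by field.
exact: lerD.
Qed.

Let H2 t x := G1 t x * G1 t x - 4 * H t x.
Let nH2 : regfield H2. Proof. by apply: regfieldB; [exact: regfieldM|exact: regfieldZ]. Qed.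

(** This is J_tt / 2. A direct chain rule would differentiate [G1], which is only Lipschitz in
    space. Instead, [is_derive_stream_flow] is subtracted for the labels th + d and th and
    integrated over time; the coefficients of [d] on both sides must agree, since all errors are of
    order d^2. *)
Let sJ_deriv th t : is_derive t 1 (fun s => slope th s * Jac th s) (3 * H2 t (chi t th) * Jac th t).
Proof.
pose q s := 3 * H2 s (chi s th) * Jac th s.
have cq : continuous q.
  apply: contM.
    by apply: contZ; exact: regfield_cont_path nH2 (@flow_cont th).
  by move=> s; exact: is_derive_continuous (is_derive_Jac th s).
have lq := continuous_lbm cq.
suff E s : slope th s * Jac th s = slope th 0 * Jac th 0 + prim q s.
  have -> : (fun s => slope th s * Jac th s) = (fun s => slope th 0 * Jac th 0 + prim q s).
    exact/funext.
  by apply: derD (is_derive_cst _ _ _) (is_derive_prim lq (cq t)) _; rewrite add0r.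
apply/eqP; rewrite -subr_eq0; apply/eqP.
have [C C0 HC] := composite_expansion `|s| nG1 dG.
have [C' C'0 HC'] := composite_expansion `|s| nH2 dH1.
(* 2 C for the expansions of [G] at the times s and 0, and 3 C' |s| for the expansion of 3 H1
   integrated over time. *)
apply: (@quadratic_zero R _ (2 * C + 3 * C' * `|s|)) => d.
have e0 := HC th (th + d) 0; rewrite normr0 in e0; have {}e0 := e0 (normr_ge0 _).
have es := HC th (th + d) s (lexx _).
have dF (u : R) : is_derive u 1 (fun u => G u (chi u (th + d)) - G u (chi u th) - d * prim q u)
   (3 * (H1 u (chi u (th + d)) - H1 u (chi u th) - H2 u (chi u th) * Jac th u * d)).
  apply: derB (derB (is_derive_stream_flow u (th + d)) (is_derive_stream_flow u th) erefl)
    (derZ (is_derive_prim lq (cq u)) erefl) _.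
  by rewrite /q; ring.
have bF : forall u, `|u| <= `|s| -> `|3 * (H1 u (chi u (th + d)) - H1 u (chi u th) - H2 u (chi u th) * Jac th u * d)|
    <= 3 * (C' * d ^+ 2).
  move=> u us; rewrite normrM normr_nat ler_wpM2l//.
  by have := HC' th (th + d) u us; rewrite (addrC th) addrK.
have := derive_bound_at0 dF bF (lexx _); rewrite prim0 mulr0 subr0 => F.
rewrite (addrC th) addrK -(addrC th) in e0 es.
rewrite (_ : _ * d ^+ 2 = 3 * (C' * d ^+ 2) * `|s| + C * d ^+ 2 + C * d ^+ 2); last by ring.
exact: linear_part_bound F es e0.
Qed.

(* The function [p = J^(-1/2)] of the header, and [w = - p']. *)
Definition invsqrtJ th t := expR (- prim (slope th) t).
Definition wslope th t := slope th t * invsqrtJ th t.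

Lemma invsqrtJ_gt0 th t : 0 < invsqrtJ th t. Proof. exact: expR_gt0. Qed.

Lemma Jac_invsqrtJ th t : Jac th t = (invsqrtJ th t) ^- 2.
Proof. by rewrite /Jac /invsqrtJ -expRM_natl -expRN; congr expR; ring. Qed.

Lemma is_derive_invsqrtJ th t : is_derive t 1 (invsqrtJ th) (- wslope th t).
Proof.
have -> : invsqrtJ th = (fun s => expR (-1 * prim (slope th) s)).
  by apply/funext => s; rewrite /invsqrtJ mulN1r.
apply: (der_comp (f := @expR R) (is_derive_expR _) (derZ (dprim th t) erefl)).
by rewrite /wslope /invsqrtJ mulN1r; ring.
Qed.

(** Since J p^2 = 1, [wslope] equals (slope J) p^3, a product whose factors are already known to be
    differentiable. The terms in slope^2 cancel and only H p survives. *)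
Lemma is_derive_wslope th t :
  is_derive t 1 (wslope th) (- (12 * H t (chi t th) * invsqrtJ th t)).
Proof.
have E s : Jac th s * (invsqrtJ th s * invsqrtJ th s) = 1.
  by rewrite Jac_invsqrtJ -expr2 mulVf// expf_neq0// gt_eqF// invsqrtJ_gt0.
have -> : wslope th = (fun s => (slope th s * Jac th s) *
     (invsqrtJ th s * (invsqrtJ th s * invsqrtJ th s))).
  by apply/funext => s; rewrite /wslope -[LHS]mulr1 -(E s); ring.
have dp := is_derive_invsqrtJ th t.
apply: derM (sJ_deriv th t) (derM dp (derM dp dp erefl) erefl) _.
rewrite /wslope /H2 -/(slope th t).
transitivity (- (12 * H t (chi t th) * invsqrtJ th t) *
  (Jac th t * (invsqrtJ th t * invsqrtJ th t))); first by rewrite E mulr1.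
ring.
Qed.

End Flow.

(** * Long-time behaviour of the flow *)

Section LongTime.
Context {R : realType}.
Variable L : R.
Hypothesis L0 : 0 < L.
Hypothesis Lpi : L <= pi / 2.
Variables (G G1 H chi : R -> R -> R).
Hypothesis nG : regfield G.
Hypothesis nG1 : regfield G1.
Hypothesis nH : regfield H.
Hypothesis HE : forall t x, H t x = Kop L (fun y => G1 t y * G1 t y) x.
Hypothesis pG1 : forall t, has_period L (G1 t).
Hypothesis pG : forall t, has_period (2 * pi) (G t).
Hypothesis dG : forall t x : R, is_derive x 1 (G t) (G1 t x).
Hypothesis chi0 : forall th, chi 0 th = th.
Hypothesis dchi : forall t th : R, is_derive t 1 (fun s => chi s th) (2 * G t (chi t th)).
Local Notation slope := (slope G1 chi).
Variables Jac p w : R -> R -> R.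
Hypothesis pE : forall th t, p th t * expR (prim (slope th) t) = 1.
Hypothesis wE : forall th t, w th t = slope th t * p th t.
Hypothesis JE : forall th t, Jac th t = p th t ^- 2.
Hypothesis dflow : forall t th : R, is_derive th 1 (chi t) (Jac th t).
Hypothesis dp : forall th t : R, is_derive t 1 (p th) (- w th t).
Hypothesis dw : forall th t : R, is_derive t 1 (w th) (- (12 * H t (chi t th) * p th t)).
Implicit Types (t s th x : R).

Let p_gt0 th t : 0 < p th t.
Proof.
have : 0 < p th t * expR (prim (slope th) t) by rewrite pE.
by rewrite pmulr_lgt0// expR_gt0.
Qed.

Let Jac_gt0 th t : 0 < Jac th t.
Proof. by rewrite JE invr_gt0 exprn_gt0. Qed.


Let lsq t : lbm (fun y => G1 t y * G1 t y).
Proof. by apply: lbmM; exact: regfield_lbm. Qed.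

Lemma pressure_ge0 t x : 0 <= H t x.
Proof. by rewrite HE; apply: Kop_ge0 => // y; rewrite -expr2 sqr_ge0. Qed.

Lemma wslope_nonincr th s t : s <= t -> w th t <= w th s.
Proof.
move=> st; apply: (derive_nonincr st (fun x _ => dw th x)) => x _.
by rewrite oppr_le0 !mulr_ge0 ?pressure_ge0// ltW.
Qed.

Lemma wslope_lt0 th t : (w th t < 0) = (slope th t < 0).
Proof. by rewrite wE pmulr_llt0. Qed.

Lemma wslope_ge0 th t : (0 <= w th t) = (0 <= slope th t).
Proof. by rewrite !leNgt wslope_lt0. Qed.

Lemma contraction_persists th s t : s <= t -> slope th s < 0 -> slope th t < 0.
Proof. by rewrite -!wslope_lt0 => st; apply: le_lt_trans; exact: wslope_nonincr. Qed.

(** The convex function [p] lies above its tangent at [s]. *)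
Lemma invsqrtJ_growth th s t : s <= t -> p th s - w th s * (t - s) <= p th t.
Proof.
move=> st.
have d (x : R) : is_derive x 1 (fun x => p th x + w th s * x) (- w th x + w th s).
  by apply: derD (dp th x) (derZ (is_derive_id _ _) erefl) _; rewrite mulr1.
have := @derive_nondecr R _ _ s t st (fun x _ => d x).
have K x : s <= x <= t -> 0 <= - w th x + w th s.
  by move=> /andP[sx _]; rewrite addrC subr_ge0 wslope_nonincr.
by move=> /(_ K); lra.
Qed.

Lemma Jac_cvg0 th s : slope th s < 0 -> Jac th t @[t --> +oo] --> (0 : R).
Proof.
rewrite -wslope_lt0 => ws; apply/cvgrPdist_le => e e0.
pose a := - w th s; have a0 : 0 < a by rewrite /a; lra.
(* From this time on the tangent at [s] exceeds e^(-1/2), so J = p^(-2) is at most [e]. *)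
exists (s + (Num.sqrt e)^-1 / a); split; first exact: num_real.
move=> t st; have se : 0 < Num.sqrt e by rewrite sqrtr_gt0.
have q0 : 0 < (Num.sqrt e)^-1 / a by rewrite divr_gt0// invr_gt0.
have P : (Num.sqrt e)^-1 <= p th t.
  have st' : s <= t by lra.
  apply: le_trans (invsqrtJ_growth th st').
  have : (Num.sqrt e)^-1 <= a * (t - s) by rewrite mulrC -ler_pdivrMr//; lra.
  by have := p_gt0 th s; rewrite /a; lra.
rewrite sub0r normrN gtr0_norm ?Jac_gt0// JE.
rewrite -[leRHS]invrK lef_pV2 ?posrE ?invr_gt0 ?exprn_gt0//.
rewrite -[in leLHS](@sqr_sqrtr _ e) ?(ltW e0)// -exprVn lerXn2r ?nnegrE ?invr_ge0 ?sqrtr_ge0//.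
exact: ltW.
Qed.

(** Uniform decay of [G'] means that for each e > 0 the active times are bounded above. *)
Definition active (e t : R) := exists x, e <= `|G1 t x|.

(** As [G1] is Lipschitz, one point with |G1| >= e brings an interval of fixed length [r] on which
    |G1| >= e / 2, and the Green kernel spreads this mass to every [x]. *)
Lemma pressure_lower (e : R) : 0 < e -> exists2 c : R, 0 < c & forall t x, active e t -> c <= H t x.
Proof.
move=> e0; have l0 := L0; have [K K0 HK] := regfield_lip nG1.
pose r := Num.min (e / 2 / K) (L / 2).
have r0 : 0 < r by rewrite lt_min !divr_gt0.
have rL : r <= L / 2 by rewrite ge_min lexx orbT.
have rK : r <= e / 2 / K by rewrite ge_min lexx.
have [|c c0 Hc] := Kop_lower L0 Lpi r0; first lra.
exists (c * (e / 2) ^+ 2); first by rewrite mulr_gt0// exprn_gt0// divr_gt0.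
move=> t x [z ez].
have [y /andP[xy yx] Ey] := periodic_reduce x z L0 (pG1 t).
rewrite -Ey in ez.
have near u : `|u - y| <= r -> (e / 2) ^+ 2 <= G1 t u * G1 t u.
  move=> ur; have h : e / 2 <= `|G1 t u|.
    have D : `|G1 t u - G1 t y| <= e / 2.
      by apply: (le_trans (HK _ _ _)); rewrite mulrC -ler_pdivlMr// (le_trans ur).
    by have := ler_distD (G1 t u) 0 (G1 t y); rewrite !sub0r !normrN; lra.
  rewrite -(expr2 (G1 t u)) -(real_normK (num_real (G1 t u))) lerXn2r ?nnegrE//.
  by rewrite divr_ge0// ltW.
rewrite HE; have sq0 u : 0 <= G1 t u * G1 t u by rewrite -expr2 sqr_ge0.
(* Since r <= L / 2, at least one of [y, y + r] and [y - r, y] lies in the window [x, x + L]. *)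
have [yr|yr] := leP (y + r) (x + L).
- apply: (Hc _ _ x y) => //; first exact: sqr_ge0.
  by move=> u /andP[u1 u2]; apply: near; rewrite ger0_norm; lra.
- apply: (Hc _ _ x (y - r)) => //; [exact: sqr_ge0|lra|lra|].
  by move=> u /andP[u1 u2]; apply: near; rewrite ler0_norm; lra.
Qed.

(** Along trajectories the slope solves the Riccati equation s' = s^2 - 12 H, whose right side is
    bounded. *)
Lemma slope_lip : exists2 C : R, 0 < C & forall th s t, `|slope th t - slope th s| <= C * `|t - s|.
Proof.
have [A A0 HA] := regfield_bound nG1; have [B B0 HB] := regfield_bound nH.
exists (A * A + 12 * B); first by rewrite addr_gt0// mulr_gt0.
move=> th.
apply: (@derive_lipschitz R (slope th) (fun t => slope th t * slope th t - 12 * H t (chi t th))); last first.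
  move=> t; apply: (le_trans (ler_normB _ _)); apply: lerD.
    by rewrite normrM ler_pM// HA.
  by rewrite normrM normr_nat ler_wpM2l.
move=> t; have dslope : is_derive t 1 (prim (slope th)) (slope th t).
  by apply: is_derive_prim; [apply: continuous_lbm|]; exact: (slope_cont nG1 dchi).
have dexp : is_derive t 1 (fun s => expR (prim (slope th) s)) (slope th t * expR (prim (slope th) t)).
  by apply: (der_comp (f := @expR R) (is_derive_expR _) dslope); rewrite mulrC.
have E : (fun s => w th s * expR (prim (slope th) s)) = slope th.
  by apply/funext => s; rewrite wE -mulrA pE mulr1.
rewrite -[X in is_derive _ _ X]E; apply: derM (dw th t) dexp _; rewrite wE.
transitivity ((slope th t * slope th t - 12 * H t (chi t th)) * (p th t * expR (prim (slope th) t))).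
  by rewrite pE mulr1.
by ring.
Qed.

Lemma flow_incr t th th' : th < th' -> chi t th < chi t th'.
Proof.
move=> lt; have [|c _ E] := @MVT R (chi t) (Jac^~ t) th th' lt (fun x _ => dflow t x).
  by apply: continuous_subspaceT => x; exact: is_derive_continuous (dflow t x).
by rewrite -subr_gt0 E mulr_gt0 ?Jac_gt0// subr_gt0.
Qed.

Lemma flow_le t th th' : th <= th' -> chi t th <= chi t th'.
Proof. by rewrite le_eqVlt => /predU1P[->//|/flow_incr/ltW]. Qed.

Let chi_cont t : continuous (chi t).
Proof. by move=> x; exact: is_derive_continuous (dflow t x). Qed.

Lemma flow_between t a b z : a <= b -> chi t a <= z <= chi t b ->
  exists2 x, a <= x <= b & chi t x = z.
Proof.
move=> ab zab; have le := flow_le t ab.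
have [||x] := @IVT R (chi t) a b z ab.
- exact: continuous_subspaceT.
- by rewrite (min_idPl le) (max_idPr le).
by rewrite in_itv/= => xab E; exists x.
Qed.

Lemma flow_surj t z : exists x, chi t x = z.
Proof.
have [A A0 HA] := regfield_bound nG.
have D th : `|chi t th - th| <= 2 * A * `|t|.
  have b s : `|2 * G s (chi s th)| <= 2 * A by rewrite normrM normr_nat ler_wpM2l.
  by have := derive_lipschitz (dchi^~ th) b 0 t; rewrite chi0 subr0.
have [||x _ E] := @flow_between t (z - 2 * A * `|t|) (z + 2 * A * `|t|) z; last by exists x.
  have h : 0 <= 2 * A * `|t| by rewrite !mulr_ge0// ltW.
  by lra.
have := D (z - 2 * A * `|t|); have := D (z + 2 * A * `|t|).
rewrite !ler_norml => /andP[? ?] /andP[? ?]; apply/andP; split; lra.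
Qed.

Lemma flow_shift t th : chi t (th + 2 * pi) = chi t th + 2 * pi.
Proof.
have [c c0 Hc] := flow_unique_gronwall nG.
have := Hc (chi^~ (th + 2 * pi)) (fun s => chi s th + 2 * pi) (dchi^~ (th + 2 * pi)) _ t.
rewrite !chi0 subrr normr0 mul0r normr_le0 subr_eq0 => K; apply/eqP; apply: K => s.
by apply: derD (dchi s th) (is_derive_cst _ _ _) _; rewrite pG addr0.
Qed.

Lemma slope_shift th t : slope (th + 2 * pi) t = slope th t.
Proof.
rewrite /slope flow_shift; have E s y : derive1 (G s) y = G1 s y.
  by rewrite derive1E (@derive_val _ _ _ _ _ _ _ (dG s y)).
by rewrite -!E derive1_periodic// => y; have [] := dG t y.
Qed.

(** The point of large strain lies on some trajectory by surjectivity of the flow, and following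
    that trajectory the strain changes at a bounded rate. *)
Lemma active_persists (e : R) : 0 < e -> exists2 d : R, 0 < d & forall t s, active e t ->
  t <= s -> s <= t + d -> active (e / 2) s.
Proof.
move=> e0; have [C C0 HC] := slope_lip; exists (e / 2 / C); first by rewrite !divr_gt0.
move=> t s [x ex] ts st; have [th E] := flow_surj t x.
exists (chi s th); rewrite -E in ex.
have D : `|slope th s - slope th t| <= e / 2.
  by apply: (le_trans (HC _ _ _)); rewrite ger0_norm ?subr_ge0// mulrC -ler_pdivlMr//; lra.
have := ler_distD (slope th s) 0 (slope th t); rewrite !sub0r !normrN /slope.
rewrite /slope in D *; lra.
Qed.

Definition expanding th := forall t, 0 <= t -> 0 <= slope th t.

(** At an expanding point [w] is still nonnegative at time s + d / 2, although w' = - 12 H p is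
    bounded away from 0 relative to p(s) until then; so w(s), and with it the slope, must be large.
    The active window is halved so that [s, s + d / 2] stays inside it. *)
Lemma expanding_slope_lower (e : R) : 0 < e -> exists k d : R, [/\ 0 < k, 0 < d &
  forall th t s, expanding th -> active e t -> 0 <= t -> t <= s -> s <= t + d -> k <= slope th s].
Proof.
move=> e0; have [d d0 Hd] := active_persists e0.
have [|c c0 Hc] := @pressure_lower (e / 2); first by rewrite divr_gt0.
have [B B0 HB] := regfield_bound nG1.
(* The exponential bounds the factor by which [p] can shrink over a time d / 2 when the slope is at
   most [B]. *)
pose q := 12 * c * expR (- (B * (d / 2))).
have q0 : 0 < q by rewrite !mulr_gt0// expR_gt0.
exists (q * (d / 2)), (d / 2); split; [by rewrite mulr_gt0// divr_gt0|by rewrite divr_gt0|].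
move=> th t s Eth at_ t0 ts st.
have ss' : s <= s + d / 2 by lra.
have lsl : lbm (slope th) by apply: continuous_lbm; exact: (slope_cont nG1 dchi).
have pl u : s <= u <= s + d / 2 -> expR (- (B * (d / 2))) * p th s <= p th u.
  move=> /andP[su us].
  have pexp v : p th v = expR (- prim (slope th) v).
    by rewrite expRN -[LHS](mulfK (lt0r_neq0 (expR_gt0 (prim (slope th) v)))) pE mul1r.
  rewrite !pexp -expRD ler_expR.
  have := @prim_boundT R (slope th) B s u lsl (fun r => HB _ _).
  rewrite ler_norml ger0_norm ?subr_ge0// => /andP[_ h].
  have : B * (u - s) <= B * (d / 2) by rewrite ler_wpM2l ?(ltW B0)//; lra.
  by lra.
have dF (u : R) : is_derive u 1 (fun u => w th u + q * p th s * u)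
    (- (12 * H u (chi u th) * p th u) + q * p th s).
  by apply: derD (dw th u) (derZ (is_derive_id _ _) erefl) _; rewrite mulr1.
have := derive_nonincr ss' (fun u _ => dF u).
have K u : s <= u <= s + d / 2 -> - (12 * H u (chi u th) * p th u) + q * p th s <= 0.
  move=> su; have := pl u su; move/andP: (su) => [su1 su2] P.
  have hc : c <= H u (chi u th) by apply: Hc; apply: Hd at_ _ _; lra.
  have : 12 * c * (expR (- (B * (d / 2))) * p th s) <= 12 * H u (chi u th) * p th u.
    apply: ler_pM => //; last by rewrite ler_wpM2l.
      by rewrite mulr_ge0// ltW.
    by rewrite mulr_ge0 ?expR_ge0// ltW.
  by rewrite /q; lra.
move=> /(_ K); have w0 : 0 <= w th (s + d / 2) by rewrite wslope_ge0; apply: Eth; lra.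
move=> h; have {h w0} : q * (d / 2) * p th s <= w th s by lra.
by rewrite wE ler_pM2r.
Qed.

(* If the gap were small at arbitrarily late active times, all points in
   between would expand, and every active time would enlarge the gap by a
   definite amount. *)
Lemma expanding_gap (e : R) : 0 < e -> exists2 h : R, 0 < h &
  forall th th', expanding th -> expanding th' -> th < th' -> th' < th + 2 * pi ->
  exists2 T : R, 0 <= T & forall t, T <= t -> active e t -> h < chi t th' - chi t th.
Proof.
move=> e0; have [k [d [k0 d0 Hk]]] := expanding_slope_lower e0.
have [K K0 HK] := regfield_lip nG1.
(* Within this distance of a point where [G1] is at least [k], the Lipschitz constant [K] keeps it
   at least k / 2. *)
exists (k / 2 / K); first by rewrite !divr_gt0.
move=> th th' Eth Eth' lt lt2.
apply: contrapT => nT.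
have late T : 0 <= T -> exists t, [/\ T <= t, active e t & chi t th' - chi t th <= k / 2 / K].
  move=> T0; apply: contrapT => nt; apply: nT; exists T => // t Tt at_.
  by rewrite ltNge; apply/negP => gt; apply: nt; exists t.
(* A point contracting at time [s] would still contract at a later active time with small gap, but
   there its slope is at least k / 2. *)
have Emid x : th <= x <= th' -> expanding x.
  move=> /andP[thx xth'] s s0; rewrite leNgt; apply/negP => sx.
  have [t [st at_ gt]] := late s s0.
  have := contraction_persists st sx; apply/negP; rewrite -leNgt.
  have tt : t <= t + d by lra.
  have t0 : 0 <= t by lra.
  have k1 := Hk th t t Eth at_ t0 (lexx t) tt.
  have c1 := flow_le t thx; have c2 := flow_le t xth'.
  have : `|slope x t - slope th t| <= k / 2.
    apply: (le_trans (HK _ _ _)); rewrite mulrC -ler_pdivlMr// ger0_norm; lra.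
  by rewrite ler_norml => /andP[? _]; lra.
pose D t := chi t th' - chi t th.
have dD (t : R) : is_derive t 1 D (2 * G t (chi t th') - 2 * G t (chi t th)).
  exact: derB (dchi t th') (dchi t th) erefl.
have D0 t : 0 < D t by rewrite subr_gt0 flow_incr.
(* By the mean value theorem the gap satisfies D' = 2 slope D for the slope at some label between th
   and th', which is an expanding one. *)
have mid t : exists2 x, th <= x <= th' &
    2 * G t (chi t th') - 2 * G t (chi t th) = 2 * slope x t * D t.
  have [|z] := @MVT R (G t) (G1 t) _ _ (flow_incr t lt) (fun x _ => dG t x).
    by apply: continuous_subspaceT => x; exact: is_derive_continuous (dG t x).
  rewrite in_itv/= => /andP[z1 z2] E.
  have [|x xth Ex] := @flow_between t th th' z (ltW lt); first by rewrite !ltW.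
  by exists x => //; rewrite -mulrBr E /slope Ex mulrA.
have Dnd s t : 0 <= s -> s <= t -> D s <= D t.
  move=> s0 st; apply: (derive_nondecr st (fun x _ => dD x)) => x /andP[sx _].
  have [y yth ->] := mid x; rewrite !mulr_ge0 ?(ltW (D0 x))//.
  by apply: Emid => //; lra.
have step t : 0 <= t -> active e t -> D t + 2 * k * D 0 * d <= D (t + d).
  move=> t0 at_.
  have dF (u : R) : is_derive u 1 (fun u => D u - 2 * k * D 0 * u)
      (2 * G u (chi u th') - 2 * G u (chi u th) - 2 * k * D 0).
    by apply: derB (dD u) (derZ (is_derive_id _ _) erefl) _; rewrite mulr1.
  have td : t <= t + d by lra.
  have := derive_nondecr td (fun u _ => dF u).
  have P u : t <= u <= t + d -> 0 <= 2 * G u (chi u th') - 2 * G u (chi u th) - 2 * k * D 0.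
    move=> /andP[tu ut]; have [y yth ->] := mid u.
    have ky := Hk y t u (Emid y yth) at_ t0 tu ut.
    have u0 : 0 <= u by lra.
    rewrite subr_ge0; apply: ler_pM; rewrite ?(ltW (D0 0))//; last exact: Dnd.
      by rewrite mulr_ge0// ltW.
    by rewrite ler_wpM2l.
  by move=> /(_ P); lra.
have grow n : exists2 T : R, 0 <= T & n%:R * (2 * k * D 0 * d) <= D T.
  elim: n => [|n [T T0 HT]]; first by exists 0 => //; rewrite mul0r ltW.
  have [t [Tt at_ _]] := late T T0; have t0 : 0 <= t by lra.
  exists (t + d); first lra.
  have := step t t0 at_; have := Dnd T t T0 Tt.
  by rewrite -addn1 natrD mulrDl mul1r; lra.
have Dmax t : D t <= 2 * pi.
  by have := flow_le t (ltW lt2); rewrite flow_shift /D; lra.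
have q0 : 0 < 2 * k * D 0 * d by rewrite !mulr_gt0.
have [T T0 HT] := grow (Num.truncn (2 * pi / (2 * k * D 0 * d))).+1.
have := truncnS_gt (2 * pi / (2 * k * D 0 * d)); rewrite ltr_pdivrMr// => h.
by have := Dmax T; lra.
Qed.

(** Gaps between consecutive points add up. The sum of the two waiting times serves as a common
    bound because both are nonnegative. *)
Lemma expanding_path_gap (e h : R) :
  (forall th th', expanding th -> expanding th' -> th < th' -> th' < th + 2 * pi ->
    exists2 T : R, 0 <= T & forall t, T <= t -> active e t -> h < chi t th' - chi t th) ->
  forall (s : seq R) x, path <%R x s -> last x s < x + 2 * pi ->
  expanding x -> (forall y, y \in s -> expanding y) ->
  exists2 T : R, 0 <= T & forall t, T <= t -> active e t ->
    (size s)%:R * h <= chi t (last x s) - chi t x.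
Proof.
move=> Hh; elim=> [|y s IH] x /=; first by exists 0 => // t _ _; rewrite mul0r subrr.
move=> /andP[xy ys] lx Ex Es.
have ly : y <= last y s.
  move: ys; rewrite (path_sortedE lt_trans) => /andP[/allP A _].
  case: s {IH lx Es} A => //= z s A; apply/ltW/A; exact: mem_last.
have [||T1 T10 H1] := IH y ys _ (Es y (mem_head _ _)).
- by lra.
- by move=> z zs; apply: Es; rewrite inE zs orbT.
have [|T2 T20 H2] := Hh x y Ex (Es y (mem_head _ _)) xy; first by lra.
exists (T1 + T2); first by lra.
move=> t tT at_; have t1 : T1 <= t by lra.
have t2 : T2 <= t by lra.
have := H1 t t1 at_; have := H2 t t2 at_.
by rewrite -addn1 natrD mulrDl mul1r; lra.
Qed.

(** With enough expanding points the consecutive gaps at a late active time would exceed the length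
    of the circle, so late times are not active. *)
Lemma strain_decay : infinite_set ([set th | expanding th] `&` `[0, 2 * pi[) ->
  forall e : R, 0 < e -> exists2 T : R, 0 <= T & forall t x, T <= t -> `|G1 t x| < e.
Proof.
move=> inf e e0; have [h h0 Hh] := expanding_gap e0.
pose n := (Num.truncn (2 * pi / h)).+1.
have hn : 2 * pi < n%:R * h by have := truncnS_gt (2 * pi / h); rewrite ltr_pdivrMr.
(* At least n + 1 points, hence at least [n] gaps, and n h > 2 pi. *)
have [B BE Bn] := infinite_set_fset n.+1 inf.
pose s := sort <=%R (finmap.enum_fset B).
have sB y : y \in s -> expanding y /\ 0 <= y < 2 * pi.
  rewrite mem_sort => yB; have [/= ? yi] := BE y yB.
  by split => //; move: yi; rewrite in_itv/=.
have ss : sorted <%R s by rewrite sort_lt_sorted finmap.fset_uniq.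
have sn : (n < size s)%N by rewrite size_sort.
case: s sB ss sn => [//|x s] sB ss sn.
have [Ex x0] := sB x (mem_head _ _).
have [_ l0] := sB _ (mem_last x s).
have Es y : y \in s -> expanding y by move=> ys; have [] := sB y; rewrite ?inE ?ys ?orbT.
have lx : last x s < x + 2 * pi by move/andP: x0 => [? _]; move/andP: l0 => [_ ?]; lra.
have [T T0 HT] := expanding_path_gap Hh ss lx Ex Es.
exists T => // t y Tt; rewrite ltNge; apply/negP => ey.
have := HT t Tt (ex_intro _ y ey).
have : n%:R * h <= (size s)%:R * h by rewrite ler_wpM2r ?(ltW h0)// ler_nat.
have := flow_le t (ltW lx); rewrite flow_shift; lra.
Qed.

End LongTime.

(** * Weak convergence *)

Section WeakConvergence.
Context {R : realType}.
Notation mu := (@lebesgue_measure R).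

(** Compactness of [0, b] through a supremum. It replaces the choice of a finite partition adapted
    to a modulus of continuity. *)
Lemma real_induction (P : R -> Prop) (b : R) : 0 <= b -> P 0 ->
  (forall x : R, 0 <= x <= b -> exists2 d : R, 0 < d & forall u v : R, 0 <= u -> u <= v -> v <= b ->
     `|u - x| < d -> `|v - x| < d -> P u -> P v) ->
  P b.
Proof.
move=> b0 P0 H; pose A := [set x : R | 0 <= x <= b /\ P x].
have A0 : A 0 by split => //; rewrite lexx.
have hA : has_sup A.
  by split; [exists 0|exists b => x [/andP[_ ?] _]].
have s0 : 0 <= sup A by apply: (sup_upper_bound hA).
have sb : sup A <= b by apply: ge_sup; [exists 0|move=> x [/andP[]]].
have [|d d0 Hd] := H (sup A); first exact/andP.
have [u [/andP[u0 ub] Pu] us] := sup_adherent d0 hA.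
have us' : u <= sup A by apply: (sup_upper_bound hA); split => //; apply/andP.
pose v := Num.min b (sup A + d / 2).
have vb : v <= b by rewrite ge_min lexx.
have vs : v <= sup A + d / 2 by rewrite ge_min lexx orbT.
have sv : sup A <= v by rewrite le_min sb; lra.
have Pv : P v.
  apply: (Hd u v) => //; first exact: le_trans sv.
  - by rewrite ler0_norm; lra.
  - by rewrite ger0_norm; lra.
have v0 : 0 <= v by exact: le_trans sv.
have vA : v <= sup A by apply: (sup_upper_bound hA); split => //; apply/andP.
suff -> : b = v by [].
apply/eqP; rewrite eq_sym eq_le vb /=; move: vA; rewrite {1}/v ge_min => /orP[bs|]; last lra.
exact: le_trans sv.
Qed.

Variables (u : R -> R -> R) (K b : R).
Hypothesis b0 : 0 <= b.
Hypothesis lu : forall t, lbm (u t).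
Hypothesis uK : forall t x, `|u t x| <= K.
Hypothesis Fu : forall x d : R, 0 < d -> exists T : R, forall t, T <= t -> `|prim (u t) x| <= d.

Let K0 : 0 <= K. Proof. exact: le_trans (uK 0 0). Qed.

Lemma weak_cvg_continuous (phi : R -> R) : continuous phi -> forall d : R, 0 < d ->
  exists T : R, forall t, T <= t -> `|prim (fun x => u t x * phi x) b| <= d.
Proof.
move=> cphi; have lphi := continuous_lbm cphi.
have lup t : lbm (fun x => u t x * phi x) by exact: lbmM.
(* On a piece where the test function oscillates by at most [e] it is replaced by a constant. The
   cost K e per unit length adds up to K e y, while [d] absorbs the remaining errors, half of it
   being left to the preceding pieces. *)
have main (e : R) : 0 < e -> forall d : R, 0 < d -> exists T : R, forall t, T <= t ->
    `|prim (fun x => u t x * phi x) b| <= K * e * b + d.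
  move=> e0; apply: (@real_induction (fun y => forall d : R, 0 < d -> exists T : R, forall t, T <= t ->
    `|prim (fun x => u t x * phi x) y| <= K * e * y + d)) => //.
    by move=> d d0; exists 0 => t _; rewrite prim0 normr0 mulr0 add0r ltW.
  move=> x _; have /continuous_at_epsP/(_ e e0)[r r0 Hr] := cphi x.
  exists r => // y z y0 yz zb yx zx IH d d0.
  have [|T1 H1] := IH (d / 2); first by rewrite divr_gt0.
  have q0 : 0 < d / 4 / (`|phi x| + 1) by rewrite !divr_gt0// ltr_wpDl.
  have [T2 H2] := Fu y q0; have [T3 H3] := Fu z q0.
  exists (`|T1| + `|T2| + `|T3|) => t Tt.
  have t1 : T1 <= t by have := ler_norm T1; have := normr_ge0 T2; have := normr_ge0 T3; lra.
  have t2 : T2 <= t by have := ler_norm T2; have := normr_ge0 T1; have := normr_ge0 T3; lra.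
  have t3 : T3 <= t by have := ler_norm T3; have := normr_ge0 T2; have := normr_ge0 T1; lra.
  have {}H1 := H1 t t1; have {}H2 := H2 t t2; have {}H3 := H3 t t3.
  pose v s := u t s * phi s - phi x * u t s.
  have lv : lbm v by apply: lbmB => //; exact: lbmZ.
  have E : prim (fun s => u t s * phi s) z = prim (fun s => u t s * phi s) y
     + (prim v z - prim v y) + phi x * (prim (u t) z - prim (u t) y).
    by rewrite /v !(primBf _ (lup t) (lbmZ (phi x) (lu t))) !(primZ _ _ (lu t)); ring.
  have Bv : `|prim v z - prim v y| <= K * e * (z - y).
    rewrite -(ger0_norm (_ : 0 <= z - y)) ?subr_ge0//.
    apply: prim_bound => // s /andP[]; rewrite (min_idPl yz) (max_idPr yz) => s1 s2.
    rewrite /v mulrC -mulrBl mulrC normrM ler_pM//; apply: Hr.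
    by move: yx zx; rewrite !ltr_norml => /andP[? ?] /andP[? ?]; apply/andP; split; lra.
  have Bp : `|phi x * (prim (u t) z - prim (u t) y)| <= d / 2.
    rewrite normrM; have : `|prim (u t) z - prim (u t) y| <= d / 2 / (`|phi x| + 1).
      apply: (le_trans (ler_normB _ _)).
      rewrite (_ : d / 2 / _ = d / 4 / (`|phi x| + 1) + d / 4 / (`|phi x| + 1)).
        exact: lerD.
      by field; rewrite gt_eqF// ltr_wpDl.
    rewrite ler_pdivlMr ?ltr_wpDl// mulrC => h; apply: le_trans h.
    by rewrite ler_wpM2r// lerDl.
  rewrite E; apply: (le_trans (ler_normD _ _)).
  have := ler_normD (prim (fun s => u t s * phi s) y) (prim v z - prim v y).
  by rewrite mulrBr in Bv; lra.
move=> d d0; have KB : 0 < 2 * (K * b + 1) by rewrite mulr_gt0// ltr_wpDl// mulr_ge0.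
have [||T HT] := main (d / (2 * (K * b + 1))) _ (d / 2) _; rewrite ?divr_gt0//.
exists T => t /HT /le_trans; apply; rewrite mulrAC.
have : K * b * (d / (2 * (K * b + 1))) <= d / 2.
  rewrite invfM mulrA [X in X <= _](_ : _ = d / 2 * ((K * b) / (K * b + 1))); last by ring.
  rewrite ler_piMr ?divr_ge0 ?(ltW d0)// ler_pdivrMr ?mul1r ?lerDl//.
  by rewrite ltr_wpDl// mulr_ge0.
lra.
Qed.

(** Continuous functions are dense in L^1, and the uniform bound [K] on [u] controls the error of
    approximation. *)
Lemma weak_cvg_integrable (phi : R -> R) : mu.-integrable `[0, b] (EFin \o phi) ->
  forall d : R, 0 < d -> exists T : R, forall t, T <= t ->
    `|\int[mu]_(x in `[0, b]) (u t x * phi x)| <= d.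
Proof.
move=> iphi d d0.
have fin : @Order.lt _ _ (mu `[0, b]) +oo%E.
  by rewrite lebesgue_measure_itv/=; case: ifP => _; rewrite ?ltry// ltry.
have [h [ch ih]] := approximation_continuous_integrable (measurable_itv _) fin iphi.
have q0 : 0 < d / 2 / (K + 1) by rewrite !divr_gt0// ltr_wpDl.
move=> /fine_cvgP[_ /cvgrPdist_le/(_ _ q0)[n _ /(_ n (leqnn n))]].
rewrite sub0r normrN => Hn.
have idiff : mu.-integrable `[0, b] (EFin \o (phi \- h n)).
  have := @integrableB _ _ _ mu _ (measurable_itv `[0, b]) _ _ iphi (ih n).
  by apply: eq_integrable => // x _ /=; rewrite EFinB.
have Hn' : \int[mu]_(x in `[0, b]) `|phi x - h n x| <= d / 2 / (K + 1).
  by apply: le_trans Hn; exact: ler_norm.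
have [T HT] := weak_cvg_continuous (ch n) (divr_gt0 d0 (ltr0n R 2)).
exists T => t Tt.
have mulu (f : R -> R) : mu.-integrable `[0, b] (EFin \o f) ->
    mu.-integrable `[0, b] (EFin \o (fun x => u t x * f x)).
  move=> fi; have := @integrableMr _ _ _ mu _ (measurable_itv `[0, b]) (u t) (EFin \o f).
  have [mut _] := lu t.
  move=> /(_ (measurable_funTS mut)) /(_ _ fi); apply.
  exists K; split; first exact: num_real.
  by move=> x Kx y _ /=; apply: le_trans (ltW Kx).
have E : \int[mu]_(x in `[0, b]) (u t x * phi x) =
   \int[mu]_(x in `[0, b]) (u t x * (phi x - h n x)) + prim (fun x => u t x * h n x) b.
  have luh : lbm (fun x => u t x * h n x) by apply: lbmM => //; exact: continuous_lbm.
  have <- : \int[mu]_(x in `[0, b]) (u t x * h n x) = prim (fun x => u t x * h n x) b.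
    by rewrite primB// prim0 subr0.
  rewrite -RintegralD//; last 2 first.
  - exact: (mulu _ idiff).
  - exact: mulu.
  by apply: eq_Rintegral => x _; ring.
rewrite E (le_trans (ler_normD _ _))// [leRHS]splitr lerD//; last exact: HT.
apply: (le_trans (le_normr_Rintegral _ _)) => //; first exact: mulu.
apply: (@le_trans _ _ (\int[mu]_(x in `[0, b]) (K * `|phi x - h n x|))).
  apply: le_Rintegral => //.
  - exact: (integrable_norm (mulu _ idiff)).
  - have := @integrableZl _ _ _ mu _ (measurable_itv `[0, b]) K _ (integrable_norm idiff).
    by apply: eq_integrable => // x _ /=; rewrite EFinM.
  - by move=> x _; rewrite normrM ler_wpM2r.
rewrite RintegralZl//; last exact: (integrable_norm idiff).
apply: (@le_trans _ _ (K * (d / 2 / (K + 1)))); first by rewrite ler_wpM2l.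
by rewrite mulrA ler_pdivrMr ?ltr_wpDl// mulrC ler_wpM2l ?divr_ge0 ?(ltW d0)// lerDl.
Qed.

End WeakConvergence.

(** * From decay of [G'] to weak convergence of [g] *)

Section WeakLimit.
Context {R : realType}.
Notation mu := (@lebesgue_measure R).
Variables (g G G1 : R -> R -> R) (M c : R).
Hypothesis lg : forall t, lbm (g t).
Hypothesis gM : forall t x, `|g t x| <= M.
Hypothesis pG1 : forall t, G1 t (2 * pi) = G1 t 0.
Hypothesis dG : forall t x : R, is_derive x 1 (G t) (G1 t x).
Hypothesis eG : forall t x y, G1 t y - G1 t x =
  prim (fun z => g t z - 4 * G t z) y - prim (fun z => g t z - 4 * G t z) x.
Hypothesis mg : forall t, prim (g t) (2 * pi) = 2 * pi * c.
Hypothesis decay : forall e : R, 0 < e -> exists2 T : R, 0 <= T & forall t x, T <= t -> `|G1 t x| < e.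

Let pi0 : 0 < 2 * pi :> R. Proof. by rewrite mulr_gt0// pi_gt0. Qed.

Let cG t : continuous (G t).
Proof. by move=> x; exact: is_derive_continuous (dG t x). Qed.

Let lG t : lbm (G t). Proof. exact/continuous_lbm/cG. Qed.

(** When [G1] is small, [G] is nearly constant in space, and its mean is c / 4 by [mg]. Hence 4 G is
    close to [c] and the primitives of g - c tend to 0. *)
Lemma weak_limit (phi : R -> R) : mu.-integrable `[0, 2 * pi] (EFin \o phi) ->
  \int[mu]_(x in `[0, 2 * pi]) (g t x * phi x) @[t --> +oo]
    --> c * \int[mu]_(x in `[0, 2 * pi]) phi x.
Proof.
move=> iphi.
have gE t x : prim (g t) x = G1 t x - G1 t 0 + 4 * prim (G t) x.
  by rewrite eG prim0 subr0 (primBf _ (lg t) (lbmZ 4 (lG t))) (primZ _ _ (lG t)); ring.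
have mG t : 4 * prim (G t) (2 * pi) = 2 * pi * c.
  by have := mg t; rewrite gE pG1 subrr add0r.
pose u t x := g t x - c.
have lu t : lbm (u t) by apply: lbmB => //; exact: lbm_cst.
have uK t x : `|u t x| <= M + `|c|.
  by apply: (le_trans (ler_normB _ _)); rewrite lerD2r.
have Fu (x d : R) : 0 < d -> exists T : R, forall t, T <= t -> `|prim (u t) x| <= d.
  (* Sum of the coefficients with which the bound on [G1] enters: 1 each for [G1 t x] and [G1 t 0],
     the rest for the integral of 4 G - c. *)
  move=> d0; pose B := 2 + 4 * ((`|x| + 2 * pi) * `|x|).
  have B0 : 0 < B.
    by rewrite ltr_pwDl// !mulr_ge0// addr_ge0// ltW.
  have [|T T0 HT] := decay (e := d / B); first by rewrite divr_gt0.
  exists T => t Tt; have {}HT y : `|G1 t y| <= d / B by rewrite ltW// HT.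
  have Glip := derive_lipschitz (dG t) HT.
  have Gc y : `|y| <= `|x| -> `|4 * G t y - c| <= 4 * (d / B * (`|x| + 2 * pi)).
    move=> yx.
    (* The deviation of [G] at [y] from its mean is an average of differences, each controlled by
       the Lipschitz constant d / B. *)
    have E : 2 * pi * (4 * G t y - c) = 4 * (prim (fun z => G t y - G t z) (2 * pi)).
      rewrite (primBf _ (lbm_cst _) (lG t)) prim_cst.
      by have := mG t; lra.
    have : `|2 * pi * (4 * G t y - c)| <= 4 * ((d / B * (`|x| + 2 * pi)) * `|2 * pi|).
      rewrite E normrM normr_nat ler_wpM2l//; apply: prim_bound0.
        by apply: lbmB => //; exact: lbm_cst.
      move=> z; rewrite (gtr0_norm pi0) => zp; apply: (le_trans (Glip _ _)).
      rewrite ler_wpM2l//; first by rewrite divr_ge0 ?ltW.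
      by apply: (le_trans (ler_normB _ _)); exact: lerD.
    by rewrite normrM (gtr0_norm pi0) mulrA [leRHS]mulrC ler_pM2l.
  have -> : prim (u t) x = G1 t x - G1 t 0 + prim (fun y => 4 * G t y - c) x.
    rewrite (primBf _ (lg t) (lbm_cst c)) gE.
    rewrite (primBf _ (lbmZ 4 (lG t)) (lbm_cst c)) (primZ _ _ (lG t)); ring.
  have P : `|prim (fun y => 4 * G t y - c) x| <= 4 * (d / B * (`|x| + 2 * pi)) * `|x|.
    apply: prim_bound0 => //; apply: lbmB; [exact: lbmZ|exact: lbm_cst].
  rewrite (_ : d = d / B + d / B + 4 * (d / B * (`|x| + 2 * pi)) * `|x|); last first.
    by transitivity (d / B * B); [rewrite divfK// gt_eqF|rewrite {2}/B; ring].
  rewrite (le_trans (ler_normD _ _))// lerD//.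
  by rewrite (le_trans (ler_normB _ _))// lerD.
apply/cvgrPdist_le => e e0.
have [T HT] := weak_cvg_integrable (ltW pi0) lu uK Fu iphi e0.
exists T; split; first exact: num_real.
move=> t /ltW/HT; rewrite distrC; apply: le_trans; rewrite le_eqVlt; apply/orP; left; apply/eqP.
congr (`| _ |); rewrite -RintegralZl// -RintegralB//.
- by apply: eq_Rintegral => x _; rewrite /u; ring.
- have := @integrableMr _ _ _ mu _ (measurable_itv `[0, 2 * pi]) (g t) (EFin \o phi).
  have [mut _] := lg t.
  move=> /(_ (measurable_funTS mut)) /(_ _ iphi); apply.
  exists M; split; first exact: num_real.
  by move=> x Kx y _ /=; apply: le_trans (ltW Kx).
- have := @integrableZl _ _ _ mu _ (measurable_itv `[0, 2 * pi]) c _ iphi.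
  by apply: eq_integrable => // x _ /=; rewrite EFinM.
Qed.

End WeakLimit.

(** * Turning times *)

Section TurningTime.
Context {R : realType}.
Implicit Types (f : R -> R) (t s : R).

(** For a function that never becomes negative the set is empty and the infimum is +oo, which is the
    value expected at expanding points. *)
Definition turning_time f : \bar R := ereal_inf (EFin @` [set t | 0 <= t /\ f t < 0]).

Lemma turning_time_ge0 f : (0 <= turning_time f)%E.
Proof. by apply: le_ereal_inf_tmp => _ [t [t0 _] <-]; rewrite lee_fin. Qed.

Lemma lt_turning_time f t : 0 <= t -> (t%:E < turning_time f)%E -> 0 <= f t.
Proof.
move=> t0; apply: contraTT; rewrite -!leNgt -ltNge => ft.
by apply: ereal_inf_lbound; exists t.
Qed.

Lemma turning_time_lt f t : (turning_time f < t%:E)%E -> exists s, [/\ 0 <= s, f s < 0 & s < t].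
Proof.
by move=> /ereal_inf_lt[_ [s [s0 fs] <-]]; rewrite lte_fin => st; exists s.
Qed.

Lemma turning_time_pinfty f : turning_time f = +oo%E <-> (forall t, 0 <= t -> 0 <= f t).
Proof.
split=> [H t t0|H]; first by apply: lt_turning_time => //; rewrite H ltry.
rewrite /turning_time (_ : [set t | _] = set0) ?image_set0 ?ereal_inf0//.
by apply/seteqP; split => // t [t0]; rewrite ltNge H.
Qed.

Lemma turning_time_fin f : (turning_time f < +oo)%E <-> exists2 t, 0 <= t & f t < 0.
Proof.
rewrite ltey; split=> [/eqP H|[t t0 ft]].
  apply: contrapT => nH; apply: H; apply/turning_time_pinfty => t t0.
  by rewrite leNgt; apply/negP => ft; apply: nH; exists t.
by apply/eqP => /turning_time_pinfty/(_ t t0); rewrite leNgt ft.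
Qed.

(** Strictly after the infimum [f] is negative by persistence. At the infimum itself, which need not
    be attained, the sign comes from continuity. *)
Lemma turning_time_le f s : continuous f ->
  (forall a b, a <= b -> f a < 0 -> f b < 0) ->
  (turning_time f <= s%:E)%E -> forall t, s <= t -> f t <= 0.
Proof.
move=> cf neg Ts.
have gt t : s < t -> f t < 0.
  move=> st; have [|r [_ fr /ltW rt]] := @turning_time_lt f t; last exact: neg rt fr.
  by apply: le_lt_trans Ts _; rewrite lte_fin.
move=> t; rewrite le_eqVlt => /predU1P[<-|/gt/ltW//].
rewrite leNgt; apply/negP => fs.
have /continuous_at_epsP/(_ (f s / 2))[|d d0 Hd] := cf s; first by rewrite divr_gt0.
have sd : `|s + d / 2 - s| < d by rewrite addrC addKr gtr0_norm; lra.
have := Hd _ sd; rewrite ler_norml => /andP[h _].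
have /gt : s < s + d / 2 by lra.
lra.
Qed.

End TurningTime.

Theorem mainTheorem1 (R : realType) (m : nat) (g0 : R -> R) (g G chi : R -> R -> R) :
  (4 <= m)%N ->
  measurable_fun setT g0 -> (exists M : R, forall x, `|g0 x| <= M) -> msym m g0 ->
  is_solution m g0 g G ->
  is_flow G chi ->
  (forall t th, derivable (chi t) th 1) /\
  (forall t th, derivable (fun s => dth chi s th) t 1) /\
  (forall s t, 0 <= s -> s <= t -> Cset chi s `<=` Cset chi t) /\
  exists T : R -> \bar R,
    (forall th, (0 <= T th)%E) /\
    (forall th, T (th + 2 * pi) = T th) /\
    (forall th s t, 0 <= s -> s <= t -> (t%:E < T th)%E ->
       dth chi s th <= dth chi t th) /\
    (forall th s t, (T th <= s%:E)%E -> s <= t ->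
       dth chi t th <= dth chi s th) /\
    closed (Eset T) /\
    open (Cinf T) /\
    (forall th, Cinf T th -> dth chi t th @[t --> +oo] --> (0 : R)) /\
    ((forall phi : R -> R,
        lebesgue_measure.-integrable `[0, 2 * pi] (EFin \o phi) ->
        Rintegral lebesgue_measure `[0, 2 * pi] (fun x => g t x * phi x)
          @[t --> +oo] --> mean g0 * Rintegral lebesgue_measure `[0, 2 * pi] phi)
     \/ finite_set (Eset T `&` `[0, 2 * pi[)).
Proof.
move=> m4 mg0 _ _ [gmeas [[M gM] [_ [gcont [gae [ell weak]]]]]] [chi0 flow].
pose L : R := 2 * pi / m%:R.
have p0 := pi_gt0 R.
have m0 : 0 < m%:R :> R by rewrite ltr0n; apply: leq_trans m4.
have m4R : 4 <= m%:R :> R by rewrite ler_nat.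
have L0 : 0 < L by rewrite divr_gt0// mulr_gt0.
have Lpi : L <= pi / 2.
  rewrite /L ler_pdivrMr// (_ : 2 * pi = pi / 2 * 4); last by field.
  by rewrite ler_wpM2l// divr_ge0// ltW.
have nL : 2 * pi = m%:R * L by rewrite /L; field; rewrite gt_eqF.
have pi2 : 0 <= 2 * pi :> R by rewrite mulr_ge0// ltW.
have lg t : lbm (g t) by apply: (@bounded_lbm _ _ M) => //; exact: (measurable_fun_pair2 t gmeas).
have pG t : has_period L (G t) by have [] := ell t.
have dG (t x : R) : is_derive x 1 (G t) (dth G t x).
  by have [_ [dG _]] := ell t; rewrite /dth derive1E; apply: derivableP.
have cG t : continuous (G t) by move=> x; exact: is_derive_continuous (dG t x).
have lgG t : lbm (fun z => g t z - 4 * G t z).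
  by apply: lbmB => //; apply: lbmZ; exact: continuous_lbm.
have eG t x y : dth G t y - dth G t x =
    prim (fun z => g t z - 4 * G t z) y - prim (fun z => g t z - 4 * G t z) x.
  have [_ [_ E]] := ell t.
  have [xy|/ltW yx] := leP x y; first by rewrite /dth E// primB.
  by apply: oppr_inj; rewrite !opprB /dth E// primB.
have tG (s e : R) : 0 < e -> exists2 d : R, 0 < d &
    forall t, `|t - s| < d -> prim (fun x => `|g t x - g s x|) (2 * L) <= e.
  move=> e0; have /cvgrPdist_le/(_ e e0)[d /= d0 Hd] := gcont s.
  exists d => // t ts; have := Hd t; rewrite /= distrC => /(_ ts).
  have ln : lbm (fun x => `|g t x - g s x|) by apply: lbm_norm; exact: lbmB.
  rewrite sub0r normrN primB// prim0 subr0 => h.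
  (* The window [0, 2 L] used for the Green operator is contained in [0, 2 pi], as 2 L <= pi. *)
  apply: le_trans (le_trans (ler_norm _) h); apply: prim_homo => //.
  by move: Lpi p0; lra.
have [nG nG1] := stream_nice L0 Lpi lg gM pG dG eG tG.
have dchi (t th : R) : is_derive t 1 (fun s => chi s th) (2 * G t (chi t th)).
  have [dc <-] := flow t th; rewrite derive1E; exact: derivableP.
pose H := Hop L G.
have nH : regfield H := regfield_Hop L0 Lpi pG dG nG1.
have nN : regfield (Nop L G) := regfield_Nop L0 Lpi pG dG nG nG1.
have evol a b x : a <= b -> G b x - G a x = prim (fun r => Nop L G r x) b - prim (fun r => Nop L G r x) a.
  exact: (evolution L0 Lpi nL lg gM pG dG eG nG nG1 weak).
have HE t x : H t x = Kop L (fun y => dth G t y * dth G t y) x by [].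
have NE t x : Nop L G t x = 3 * Hop1 L G t x - 2 * (G t x * dth G t x) by [].
have dH1 := is_derive_Hop1 L0 Lpi pG dG nG1.
pose sl := slope (dth G) chi.
pose J := Jac (dth G) chi; pose p := invsqrtJ (dth G) chi; pose w := wslope (dth G) chi.
have dflow : forall t th : R, is_derive th 1 (chi t) (J th t) := is_derive_flow nG nG1 dG chi0 dchi.
have dp : forall th t : R, is_derive t 1 (p th) (- w th t) := is_derive_invsqrtJ nG1 dchi.
have dw : forall th t : R, is_derive t 1 (w th) (- (12 * H t (chi t th) * p th t)) :=
  is_derive_wslope nG nG1 nH nN dG dH1 NE evol chi0 dchi.
have dJ : forall th t : R, is_derive t 1 (J th) (2 * sl th t * J th t) := is_derive_Jac nG1 dchi.
have pE th t : p th t * expR (prim (sl th) t) = 1 by rewrite /p /invsqrtJ -expRD addNr expR0.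
have wE th t : w th t = sl th t * p th t by [].
have JE th t : J th t = p th t ^- 2 := Jac_invsqrtJ _ _ th t.
have J0 th t : 0 < J th t := Jac_gt0 _ _ th t.
have pG2 t : has_period (2 * pi) (G t) by move=> x; rewrite nL has_periodn.
have dthE t th : dth chi t th = J th t.
  by rewrite /dth derive1E (@derive_val _ _ _ _ _ _ _ (dflow t th)).
have dthF th : (fun s => dth chi s th) = J th by apply/funext => s; exact: dthE.
have CE t th : Cset chi t th <-> sl th t < 0.
  rewrite /Cset /= /dt dthF derive1E (@derive_val _ _ _ _ _ _ _ (dJ th t)).
  by rewrite pmulr_llt0// pmulr_rlt0.
have neg th a b : a <= b -> sl th a < 0 -> sl th b < 0.
  exact: (contraction_persists L0 Lpi nG1 HE pE wE dw).
have csl th : continuous (sl th) by exact: (slope_cont nG1 dchi).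
split; first by move=> t th; have [] := dflow t th.
split; first by move=> t th; rewrite dthF; have [] := dJ th t.
split; first by move=> s t _ st th /CE/(neg th s t st)/CE.
exists (fun th => turning_time (sl th)).
have EsetE : Eset (fun th => turning_time (sl th)) = [set th | expanding (dth G) chi th].
  by apply/seteqP; split => th /turning_time_pinfty.
(* Written as a union over times of sets that are open because the slope at a fixed time is
   continuous in the label. *)
have CinfE : Cinf (fun th => turning_time (sl th)) =
    \bigcup_(t in [set t : R | 0 <= t]) (fun th => sl th t) @^-1` [set x | x < 0].
  by apply/seteqP; split => [th /turning_time_fin[t t0 st]|th [t t0 st]];
    [exists t|apply/turning_time_fin; exists t].
have oC : open (Cinf (fun th => turning_time (sl th))).
  rewrite CinfE; apply: bigcup_open => t _; apply: open_comp; last exact: open_lt.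
  move=> th _; apply: (@continuous_comp _ _ _ (chi t) (dth G t)).
    exact: is_derive_continuous (dflow t th).
  exact: regfield_cont_space.
split; first by move=> th; exact: turning_time_ge0.
split.
  move=> th; congr turning_time; apply/funext => t.
  exact: (slope_shift nG pG2 dG chi0 dchi).
split.
  move=> th s t s0 st tT; rewrite !dthE.
  apply: (derive_nondecr st (fun x _ => dJ th x)) => x /andP[sx xt].
  rewrite !mulr_ge0 ?(ltW (J0 _ _))//; apply: lt_turning_time; first exact: le_trans sx.
  by apply: le_lt_trans tT; rewrite lee_fin.
split.
  move=> th s t Ts st; rewrite !dthE.
  apply: (derive_nonincr st (fun x _ => dJ th x)) => x /andP[sx _].
  rewrite pmulr_lle0// pmulr_rle0//.
  exact: (turning_time_le (@csl th) (neg th) Ts).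
split.
  rewrite (_ : Eset _ = ~` Cinf (fun th => turning_time (sl th))); first exact: open_closedC.
  apply/seteqP; split => th; rewrite /Eset /Cinf /= ltey; first by move=> ->; rewrite eqxx.
  by move=> /negP; rewrite negbK => /eqP.
split; first exact: oC.
split.
  move=> th /turning_time_fin[t _ st]; rewrite dthF.
  exact: (Jac_cvg0 L0 Lpi nG1 HE pE wE JE dp dw st).
have [fin|inf] := pselect (finite_set (Eset (fun th => turning_time (sl th)) `&` `[0, 2 * pi[)).
  by right.
left=> phi iphi; rewrite EsetE in inf.
have decay := strain_decay L0 Lpi nG nG1 nH HE (dth_periodic pG dG) pG2 dG chi0 dchi pE wE JE dflow dw inf.
(* The mean is conserved, and g(0) agrees with [g0] almost everywhere. *)
have mgc t : prim (g t) (2 * pi) = 2 * pi * mean g0.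
  rewrite (mean_conserved L0 nL lg gM pG dG eG nG nG1 weak 0 t).
  have h := primB (lg 0) pi2; rewrite prim0 subr0 in h.
  rewrite -h /mean mulVKf ?gt_eqF ?mulr_gt0//.
  rewrite /Rintegral; congr fine; apply: ae_eq_integral => //.
  - by apply/measurable_EFinP/measurable_funTS; have [] := lg 0.
  - exact/measurable_EFinP/measurable_funTS.
  - by apply: negligibleS gae => x /= ne eq; apply: ne => _; rewrite eq.
apply: (weak_limit lg gM _ dG eG mgc decay iphi) => t.
have /(_ 0) := dth_periodic pG dG t; move=> _.
by rewrite -[2 * pi]add0r nL; exact: (has_periodn m 0 (dth_periodic pG dG t)).
Qed.
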